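(* Let $m\ge n\ge2$ and $M=\binom n2$. Every maximum $C_4$-free $m\times n$ base $B$ with $m\ge M$ satisfies \[ T^*(B)\ge\frac n3\min\{m,n^2\}-20m. \] Moreover, there is an absolute constant $\kappa>0$ such that, for $m\ge n^2$, the maximum base $B_{\rm can}$ consisting of one row for every column pair (the row for $\{c,d\}$ having fixed cells exactly in columns $c$ and $d$) and $m-M$ singleton rows all having their single fixed cell in column $1$ satisfies \[ T^*(B_{\rm can})\le\frac{mn}{3}-\kappa n(m-n^2)+4m. \]
   Context: An $m\times n$ binary matrix is identified with the set of its occupied cells $(r,c)\in[m]\times[n]$ (entries equal to $1$). It is $C_4$-free if it has no all-one $2\times2$ submatrix (two distinct rows, two distinct columns). Let $z(m,n)$ be the maximum number of occupied cells in a $C_4$-free $m\times n$ binary matrix. A base is a $C_4$-free set of fixed cells $B\subseteq[m]\times[n]$; it is maximum if $|B|=z(m,n)$. A selected pair is an unordered pair of distinct cells outside $B$. It is nondegenerate if its two cells lie in distinct rows and distinct columns; degenerate pairs (repeated row or repeated column) are also allowed. Given a family $E_2$ of selected pairs, let $O$ be the union of $B$ and all cells of pairs in $E_2$. The family $E_2$ is an admissible augmentation of $B$ if: (S) each cell is used by at most one selected pair; (C2) for each nondegenerate selected pair $((r,c),(s,d))$, the opposite cells $(r,d)$ and $(s,c)$ are not both in $O$; (C3) for each selected pair $((r,c),(s,d))$ (degenerate or not) and all $x\in[m]\setminus\{r,s\}$, $y\in[n]\setminus\{c,d\}$, at least one of the cells $(x,y),(x,c),(x,d),(r,y),(s,y)$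 lies outside $O$. $T^*(B)$ is the maximum of $|E_2|$ over admissible augmentations of the given base $B$. *)

(* Defs.v *)
From mathcomp Require Import all_boot all_order all_algebra.
From mathcomp Require Import reals.

Set Implicit Arguments.
Unset Strict Implicit.
Unset Printing Implicit Defensive.

(* An m x n binary matrix is its set of occupied cells (row, column); rows and
   columns are numbered from 0. *)
Notation cell m n := ('I_m * 'I_n)%type.

Definition c4_free m n (B : {set cell m n}) : bool :=
  [forall r, forall s, forall c, forall d, (r != s) ==> (c != d) ==>
     ~~ [&& (r, c) \in B, (r, d) \in B, (s, c) \in B & (s, d) \in B]].

Definition zarankiewicz m n : nat :=
  \max_(B : {set cell m n} | c4_free B) #|B|.

Definition maximum_base m n (B : {set cell m n}) : bool :=
  c4_free B && (#|B| == zarankiewicz m n).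

Definition selected_pair m n (B P : {set cell m n}) : bool :=
  (#|P| == 2) && [disjoint P & B].

Definition occupied m n (B : {set cell m n}) (E : {set {set cell m n}}) :
  {set cell m n} := B :|: cover E.

(* In C2 and C3 each pair of E is met as [set (r, c); (s, d)] in both orders;
   the singletons ((r, c) = (s, d)) are excluded by selected_pair. *)
Definition cond_C2 m n (B : {set cell m n}) (E : {set {set cell m n}}) : bool :=
  [forall r, forall c, forall s, forall d,
     ([set (r, c); (s, d)] \in E) ==> (r != s) ==> (c != d) ==>
     ~~ (((r, d) \in occupied B E) && ((s, c) \in occupied B E))].

Definition cond_C3 m n (B : {set cell m n}) (E : {set {set cell m n}}) : bool :=
  [forall r, forall c, forall s, forall d,
     ([set (r, c); (s, d)] \in E) ==>
     [forall x, forall y,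
        (x \notin [set r; s]) ==> (y \notin [set c; d]) ==>
        ~~ [&& (x, y) \in occupied B E, (x, c) \in occupied B E,
               (x, d) \in occupied B E, (r, y) \in occupied B E
             & (s, y) \in occupied B E]]].

Definition admissible m n (B : {set cell m n}) (E : {set {set cell m n}}) :
    bool :=
  [&& [forall P in E, selected_pair B P], trivIset E, cond_C2 B E
    & cond_C3 B E].

Definition Tstar m n (B : {set cell m n}) : nat :=
  \max_(E : {set {set cell m n}} | admissible B E) #|E|.

Definition row_support m n (B : {set cell m n}) (r : 'I_m) : {set 'I_n} :=
  [set c | (r, c) \in B].

Definition first_column n : {set 'I_n} := [set c : 'I_n | c == 0 :> nat].

(* The canonical base is determined only up to the order of its rows; the
   predicate accepts every order. When 'C(n, 2) <= m the two clauses account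
   for all m rows. *)
Definition canonical_base m n (B : {set cell m n}) : Prop :=
  (forall Q : {set 'I_n}, #|Q| = 2 -> #|[set r | row_support B r == Q]| = 1)
  /\ #|[set r | row_support B r == first_column n]| = m - 'C(n, 2).

Lemma canonical_base_exists m n :
  'C(n, 2) <= m -> exists B : {set cell m n}, canonical_base B.
Proof.
move=> leMm.
pose A := [set Q : {set 'I_n} | #|Q| == 2].
have szA : size (enum A) = 'C(n, 2).
  by rewrite -cardE card_draws card_ord.
pose row i := nth (first_column n) (enum A) i.
have fcA : first_column n \notin A.
  rewrite inE neq_ltn ltnS; apply/orP; left.
  apply/card_le1P => a; rewrite inE => /eqP a0 b; rewrite !inE.
  by rewrite -val_eqE /= a0.
exists [set x : cell m n | x.2 \in row x.1].
have rsE r : row_support [set x : cell m n | x.2 \in row x.1] r = row r.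
  by apply/setP => c; rewrite !inE.
split=> [Q Q2|].
  have QA : Q \in enum A by rewrite mem_enum inE Q2.
  have ltQ : index Q (enum A) < m.
    by apply: leq_trans leMm; rewrite -szA index_mem.
  apply/eqP/cards1P; exists (Ordinal ltQ); apply/setP => r.
  rewrite !inE rsE.
  apply/eqP/eqP => [rQ|->]; last by rewrite /row /= nth_index.
  have ltr : r < size (enum A).
    rewrite ltnNge; apply/negP => ler.
    by move: QA; rewrite -rQ /row nth_default // mem_enum (negPf fcA).
  apply: val_inj => /=; rewrite -(index_uniq (first_column n) ltr (enum_uniq _)).
  by rewrite -/(row r) rQ.
have -> : [set r | row_support [set x : cell m n | x.2 \in row x.1] r
                   == first_column n] = ~: [set r : 'I_m | r < 'C(n, 2)].
  apply/setP => r; rewrite !inE rsE -szA -leqNgt.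
  apply/eqP/idP => [rf|ler]; last by rewrite /row nth_default.
  rewrite leqNgt; apply/negP => ltr.
  by move: fcA; rewrite -rf -mem_enum mem_nth.
rewrite cardsCs setCK card_ord; congr (_ - _).
have -> : [set r : 'I_m | r < 'C(n, 2)] = [set widen_ord leMm i | i in 'I_('C(n, 2))].
  apply/setP => r; rewrite inE; apply/idP/imsetP => [ltr|[i _ ->]] /=; last exact: ltn_ord.
  by exists (Ordinal ltr) => //; apply/val_inj.
by rewrite card_imset ?card_ord // => i j /(congr1 val) /= /val_inj.
Qed.

(* Main.v *)
Require Import Defs.
From mathcomp Require Import all_boot all_order all_algebra.
From mathcomp Require Import reals.
From mathcomp Require Import ring lra zify.

Set Implicit Arguments.
Unset Strict Implicit.
Unset Printing Implicit Defensive.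

Import Order.TTheory GRing.Theory Num.Theory.

(** Why the bounds hold.

    Lower bound.  Counting column pairs gives z(m, n) = m + 'C(n, 2), and
    equality forces every row of a maximum base to have one or two cells and
    every column pair to span exactly one row (extremal_base).  Cut all but a
    few columns into three parts of equal size k, and give equally many rows
    each of three types; beyond its base cells, a row of type u occupies just
    the columns of the two parts other than part u.  A row of type u and a row
    of type v can then be joined by the pairs whose cells are the crossing ones:
    the first row in a column of part v, the second in a column of part u.  The
    two opposite cells are empty, so C2 holds; a column common to both rows lies
    in the third part, so a row violating C3 would meet all three parts, which
    no row does (layout_family_admissible).  All cells of the typed rows outside
    the omitted parts are used: n/3 pairs for each row.  Two things may go
    wrong.  A row whose base cell lies in part u cannot get type u; dealing the
    columns out in the order of their numbers of single rows, the heaviest one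
    going to no part, leaves enough choice (deal_columns, three_way_split).  Two
    joined rows may share a base cell in a column of no part; so a row of size
    one is always joined to a row of size two inside the parts, and this is
    where the bound stops growing at m = n ^ 2, about twice the number of column pairs.

    Upper bound.  Let O be the occupied set.  Condition C3 says that if both
    rows of a pair meet a column y, then no further row through y meets both
    columns of the pair: among the rows through y, these two columns are almost
    disjoint.  For each y this yields an inequality between the sizes of the rows
    through y and the number of pairs inside them (lack_ge), and its sum over y
    gives |O| <= 2mn/3 + O(m), hence mn/3 pairs.  The sum also shows that, with
    deficit the amount by which |O| falls short of 2mn/3, the squares of the
    deviations of the row sizes from 2n/3 add up to O(n (deficit + m))
    (sum_lack).  C3 is symmetric in rows and columns, so the same holds for the
    column sizes and 2m/3.

    For the canonical base let y0 be the first column.  At most n ^ 2 / 2 rows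
    miss y0.  If both rows of a pair pass through y0, every further row through
    the two columns of the pair misses y0, so it carries a column pair, and it
    avoids the n/3 or so columns common to the two rows; that leaves at most
    2n^2/9 such rows where m/3 are expected, unless the sizes involved are
    atypical.  The square bounds therefore make such pairs rare
    (anchored_pairs_le): up to O(deficit + m), each pair has a cell in a row
    that misses y0.  It remains to see that those rows contain at most 2n/3
    cells on average, again up to O(deficit + m) in total; the square bounds
    alone would lose a square root.  The inequality for a single row bounds its
    excess by minus the excesses of its columns (row_dev_le), so summing over
    the rows that miss y0 leaves the inner product of the column excesses with
    the numbers of such rows in the columns.  As nearly all pairs join the two
    classes of rows, each class covers half of every column in square mean
    (discrepancy, sum_bias_sqr), and the inner product becomes a sum of
    squares.  With 2 #rows missing y0 <= n ^ 2 this gives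
    deficit >= c n (m - n ^ 2) - O(m). *)

(** * Elementary inequalities *)

Section Elementary.
Local Open Scope ring_scope.

Lemma double_bin2 w : (2 * 'C(w, 2) = w * w.-1)%N.
Proof. by rewrite mulnC (bin_ffact w 2) ffactnS ffactn1. Qed.

Lemma double_bin2_le w : (2 * 'C(w, 2) <= w ^ 2)%N.
Proof. by rewrite double_bin2 -mulnn leq_mul ?leq_pred. Qed.

Lemma sum_indicator (R : realFieldType) (T : finType) (x : T) :
  \sum_y (y == x)%:R = 1 :> R.
Proof.
by rewrite (bigD1 x) //= eqxx big1 ?addr0 // => y /negPf ->.
Qed.

Lemma sum_constR (R : realFieldType) (T : finType) (x : R) :
  \sum_(i : T) x = #|T|%:R * x.
Proof. by rewrite sumr_const mulr_natl. Qed.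

Lemma sum_mem (R : realFieldType) (T : finType) (A : {set T}) :
  \sum_i (i \in A)%:R = #|A|%:R :> R.
Proof.
by rewrite -sum1_card natr_sum [RHS]big_mkcond; apply: eq_bigr => i _; case: (i \in A).
Qed.

Lemma sqr_sum_le (R : realFieldType) (T : finType) (f : T -> R) :
  (\sum_i f i) ^+ 2 <= #|T|%:R * \sum_i f i ^+ 2.
Proof.
set S := \sum_i f i; set N : R := #|T|%:R.
have [N_0|Np] := eqVneq N 0.
  have T0 : #|T| = 0%N by apply/eqP; rewrite -(pnatr_eq0 R) -/N N_0.
  rewrite N_0 mul0r /S big1 ?expr0n // => i _.
  by have := fintype0 i T0.
have {}Np : 0 < N by rewrite lt_def Np /N ler0n.
have : 0 <= \sum_i (N * f i - S) ^+ 2 by apply: sumr_ge0 => i _; exact: sqr_ge0.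
have -> : \sum_i (N * f i - S) ^+ 2 = N * (N * \sum_i f i ^+ 2 - S ^+ 2).
  transitivity (\sum_i (N ^+ 2 * f i ^+ 2 - 2 * N * S * f i + S ^+ 2)).
    by apply: eq_bigr => i _; ring.
  rewrite !big_split /= sumrN -!mulr_sumr -/S sumr_const -mulr_natl -/N; ring.
by rewrite (pmulr_rge0 _ Np) subr_ge0.
Qed.

Lemma sqr_abs_le (R : realFieldType) (x y : R) : `|x| <= y -> x ^+ 2 <= y ^+ 2.
Proof. by move=> h; rewrite -real_normK ?num_real // lerXn2r ?nnegrE // (le_trans _ h). Qed.

Lemma norm_mul_le (R : realFieldType) (a x : R) :
  `|a| <= 1 -> 0 <= x -> `|a * x| <= x.
Proof. by move=> a1 x0; rewrite normrM [`|x|]ger0_norm // ler_piMl. Qed.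

Lemma defect_weight_ge0 (R : realFieldType) (N a b : R) : 0 <= b -> b <= a -> a <= N ->
  0 <= N * ((a - b) * (N - a)) + b * (2 * a - N) ^+ 2.
Proof.
move=> b0 ba aN; have N0 := le_trans (le_trans b0 ba) aN.
apply: addr_ge0; apply: mulr_ge0; rewrite ?sqr_ge0 //.
by rewrite mulr_ge0 ?subr_ge0.
Qed.

(** The second factor on the right is the local defect of the counting argument
    for one column: N rows pass through y, a of them also through another column,
    and b of these last incidences are used by pairs inside the N rows.  Its
    product with a is the left-hand side, a sum of nonnegative terms.  For N > 0
    the defect vanishes only at (a, b) = (N, 0) and (N/2, N/2), the two values
    that occur in an extremal configuration. *)
Lemma defect_ineq (R : realFieldType) (N a b : R) : 0 <= b -> b <= a -> a <= N ->
  N * ((a - b) * (N - a)) + b * (2 * a - N) ^+ 2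
    <= N * (N ^+ 2 - N * a - 3 * N * b + 4 * a * b).
Proof.
move=> b0 ba aN.
have a0 := le_trans b0 ba.
have N0 := le_trans a0 aN.
have [a_0|ap] := eqVneq a 0.
  have b_0 : b = 0 by apply/eqP; rewrite eq_le b0 andbT -a_0.
  rewrite a_0 b_0; have := mulr_ge0 N0 (sqr_ge0 N); nra.
have {}ap : 0 < a by rewrite lt_def ap.
rewrite -subr_ge0 -(pmulr_rge0 _ ap).
set w := N * ((a - b) * (N - a)) + _.
have w0 : 0 <= w by exact: defect_weight_ge0.
have -> : a * (N * (N ^+ 2 - N * a - 3 * N * b + 4 * a * b) - w) = (N - a) * w.
  by rewrite /w; ring.
by rewrite mulr_ge0 ?subr_ge0.
Qed.

(** Stability form of the same fact: A, B, C are signed counts dominated by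
    a - b, N - a and b, and the combination on the left vanishes at both extremal
    values of (a, b). *)
Lemma defect_sqr (R : realFieldType) (N a b A B C : R) :
  0 <= b -> b <= a -> a <= N -> `|A| <= a - b -> `|B| <= N - a -> `|C| <= b ->
  (B * (2 * a - N) + C * (2 * a - N) - 2 * A * (N - a)) ^+ 2
    <= 18 * (N ^+ 2 * (N ^+ 2 - N * a - 3 * N * b + 4 * a * b)).
Proof.
move=> b0 ba aN hA hB hC.
have a0 := le_trans b0 ba; have N0 := le_trans a0 aN.
set v := _ - _ - _ + _; set w := N * ((a - b) * (N - a)) + b * (2 * a - N) ^+ 2.
have av : a * v = w by rewrite /v /w; ring.
have wv : N * w <= N ^+ 2 * v.
  by rewrite expr2 -mulrA ler_wpM2l // defect_ineq.
have q0 : 0 <= (a - b) * (N - a) by rewrite mulr_ge0 ?subr_ge0.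
have qN : (a - b) * (N - a) <= N ^+ 2.
  by rewrite expr2 ler_pM ?subr_ge0 //; lra.
have p0 := sqr_ge0 (2 * a - N).
have pN : (2 * a - N) ^+ 2 <= N ^+ 2.
  by apply: sqr_abs_le; rewrite ler_norml; apply/andP; split; lra.
have rN : (N - a) ^+ 2 <= N ^+ 2.
  by apply: sqr_abs_le; rewrite ler_norml; apply/andP; split; lra.
have bp0 := mulr_ge0 b0 p0.
have x1 : ((a - b) * (N - a)) ^+ 2 <= N ^+ 2 * v.
  apply: le_trans wv; rewrite /w.
  set q := (a - b) * (N - a) in q0 qN *; set p := b * _ in bp0 *.
  have h1 : 0 <= q * (N ^+ 2 - q) by rewrite mulr_ge0 ?subr_ge0.
  have h2 := mulr_ge0 N0 bp0; nra.
have x3 : (b * (2 * a - N)) ^+ 2 <= N ^+ 2 * v.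
  apply: le_trans wv; rewrite /w exprMn.
  set q := (a - b) * (N - a) in q0 qN *; set p := (2 * a - N) ^+ 2 in p0 bp0 *.
  have h1 := mulr_ge0 (mulr_ge0 N0 N0) q0.
  have h2 : 0 <= (N - b) * (b * p) by rewrite mulr_ge0 // subr_ge0 (le_trans ba).
  nra.
have x2 : ((N - a) * (2 * a - N)) ^+ 2 <= N ^+ 2 * v.
  have [a_0|ap] := eqVneq a 0.
    have b_0 : b = 0 by apply/eqP; rewrite eq_le b0 andbT -a_0.
    rewrite /v a_0 b_0 le_eqVlt; apply/orP; left; apply/eqP; ring.
  have {}ap : 0 < a by rewrite lt_def ap.
  rewrite -(ler_pM2l ap) [a * (N ^+ 2 * v)]mulrCA av /w exprMn.
  set p := (2 * a - N) ^+ 2 in p0 pN bp0 *.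
  have h1 : 0 <= b * p * (N ^+ 2 - (N - a) ^+ 2) by rewrite mulr_ge0 ?subr_ge0.
  have h2 : (N - a) * p <= N * N ^+ 2 by rewrite ler_pM ?subr_ge0 //; lra.
  have h3 : 0 <= (a - b) * (N - a) * (N * N ^+ 2 - (N - a) * p).
    by rewrite mulr_ge0 ?subr_ge0.
  by move: h1 h3; clear; lra.
have y1 : (A * (N - a)) ^+ 2 <= N ^+ 2 * v.
  apply: le_trans x1; rewrite !exprMn ler_wpM2r ?sqr_ge0 //; exact: sqr_abs_le.
have y2 : (B * (2 * a - N)) ^+ 2 <= N ^+ 2 * v.
  apply: le_trans x2; rewrite !exprMn ler_wpM2r ?sqr_ge0 //; exact: sqr_abs_le.
have y3 : (C * (2 * a - N)) ^+ 2 <= N ^+ 2 * v.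
  apply: le_trans x3; rewrite !exprMn ler_wpM2r ?sqr_ge0 //; exact: sqr_abs_le.
rewrite -mulrA; move: y1 y2 y3.
set X := A * _; set Y := B * _; set Z := C * _ => y1 y2 y3.
have z1 := sqr_ge0 (Y - Z); have z2 := sqr_ge0 (Y + 2 * X); have z3 := sqr_ge0 (Z + 2 * X).
lra.
Qed.

End Elementary.

(** * Packings and the counting inequality *)

(** Pairs are indexed by an arbitrary finite type K; pair k consists of the cells
    (r k, c k) and (s k, d k). *)
Definition usage (I J K : finType) (r s : K -> I) (c d : K -> J) i j : nat :=
  (\sum_k ((r k == i) && (c k == j)) + \sum_k ((s k == i) && (d k == j)))%N.

(** Conditions S and C3 alone.  The first clause also says that the cells of the
    pairs are occupied.  Leaving out C2 and the base makes the notion invariant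
    under exchanging rows and columns. *)
Definition packing (I J K : finType) (O : I -> J -> bool)
    (r s : K -> I) (c d : K -> J) : Prop :=
  (forall i j, (usage r s c d i j <= O i j)%N) /\
  (forall k x y, x != r k -> x != s k -> y != c k -> y != d k ->
     ~~ [&& O x y, O x (c k), O x (d k), O (r k) y & O (s k) y]).

Definition transpose (I J : Type) (O : I -> J -> bool) j i := O i j.

Lemma packing_transpose (I J K : finType) (O : I -> J -> bool)
    (r s : K -> I) (c d : K -> J) :
  packing O r s c d -> packing (transpose O) c d r s.
Proof.
move=> [h1 h2]; split=> [j i|k y x yc yd xr xs].
  rewrite (leq_trans _ (h1 i j)) // /usage.
  by apply: eq_leq; congr (_ + _)%N; apply: eq_bigr => k _; rewrite andbC.
apply: contra (h2 k x y xr xs yc yd); rewrite /transpose.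
by case/and5P => -> -> -> -> ->.
Qed.

Section Packing.
Local Open Scope ring_scope.
Variables (R : realFieldType) (I J K : finType) (O : I -> J -> bool).
Variables (r s : K -> I) (c d : K -> J).
Hypothesis pk : packing O r s c d.

Notation o i j := ((O i j)%:R : R).
Notation us i j := ((usage r s c d i j)%:R : R).
Notation m := (#|I|%:R : R).
Notation n := (#|J|%:R : R).

Definition row_size i : R := \sum_j o i j.
Definition col_size j : R := \sum_i o i j.
Definition total : R := \sum_i row_size i.
Definition unpaired : R := \sum_i \sum_j (o i j - us i j).

Definition load (w : K -> R) i j : R :=
  \sum_k w k * (((r k == i) && (c k == j))%:R + ((s k == i) && (d k == j))%:R).

Lemma usage_le i j : us i j <= o i j.
Proof. by rewrite ler_nat; case: pk. Qed.

Lemma usage_load i j : us i j = load (fun _ => 1) i j.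
Proof.
rewrite /usage natrD !natr_sum -big_split; apply: eq_bigr => k _.
by rewrite mul1r.
Qed.

Lemma total_col : total = \sum_j col_size j.
Proof. by rewrite /total exchange_big. Qed.

Lemma sum_load (w : K -> R) (g : I -> J -> R) :
  \sum_k w k * (g (r k) (c k) + g (s k) (d k)) = \sum_i \sum_j load w i j * g i j.
Proof.
have aux (a : K -> I) (b : K -> J) k : g (a k) (b k) =
    \sum_i \sum_j ((a k == i) && (b k == j))%:R * g i j.
  rewrite (bigD1 (a k)) //= (bigD1 (b k)) //= !eqxx mul1r.
  rewrite [X in _ = _ + X + _]big1 => [|j /negPf bj]; last by rewrite eq_sym bj mul0r.
  rewrite [X in _ = _ + X]big1 ?addr0 // => i /negPf ai.
  by rewrite big1 // => j _; rewrite eq_sym ai mul0r.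
under [RHS]eq_bigr do under eq_bigr do rewrite mulr_suml.
under [RHS]eq_bigr do rewrite exchange_big.
rewrite exchange_big; apply: eq_bigr => k _ /=.
rewrite (aux r c) (aux s d) -big_split mulr_sumr; apply: eq_bigr => i _ /=.
rewrite -big_split mulr_sumr; apply: eq_bigr => j _ /=.
by rewrite -mulrA mulrDl.
Qed.

Lemma sum_pair_cells (g : I -> J -> R) :
  \sum_k (g (r k) (c k) + g (s k) (d k)) = \sum_i \sum_j us i j * g i j.
Proof.
under [RHS]eq_bigr do under eq_bigr do rewrite usage_load.
by rewrite -sum_load; apply: eq_bigr => k _; rewrite mul1r.
Qed.

Lemma sum_pair_cells_le (g : I -> J -> R) : (forall i j, 0 <= g i j) ->
  \sum_k (g (r k) (c k) + g (s k) (d k)) <= \sum_i \sum_j o i j * g i j.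
Proof.
move=> g0; rewrite sum_pair_cells; apply: ler_sum => i _; apply: ler_sum => j _.
by rewrite ler_wpM2r ?usage_le.
Qed.

Lemma load_ge0 w i j : (forall k, 0 <= w k) -> 0 <= load w i j.
Proof. by move=> w0; apply: sumr_ge0 => k _; rewrite mulr_ge0 ?addr_ge0. Qed.

Lemma load_le w i j : (forall k, w k <= 1) -> load w i j <= us i j.
Proof.
move=> w1; rewrite usage_load; apply: ler_sum => k _.
by rewrite ler_wpM2r ?addr_ge0.
Qed.

Lemma unpaired_ge0 : 0 <= unpaired.
Proof. by apply: sumr_ge0 => i _; apply: sumr_ge0 => j _; rewrite subr_ge0 usage_le. Qed.

Lemma double_pairs : 2 * #|K|%:R = total - unpaired.
Proof.
have := sum_pair_cells (fun _ _ => 1); rewrite sumr_const => e.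
transitivity (\sum_i \sum_j us i j * 1); first by rewrite -e mulr_natr.
rewrite /total /unpaired /row_size -sumrB.
by apply: eq_bigr => i _; rewrite -sumrB; apply: eq_bigr => j _; ring.
Qed.

Lemma col_size_ge0 j : 0 <= col_size j. Proof. exact: sumr_ge0. Qed.

Lemma row_size_le i : row_size i <= n.
Proof.
rewrite -sum1_card natr_sum; apply: ler_sum => j _.
by case: (O i j).
Qed.

Lemma col_size_le j : col_size j <= m.
Proof.
rewrite -sum1_card natr_sum; apply: ler_sum => i _.
by case: (O i j).
Qed.

Lemma total_le : total <= m * n.
Proof. by rewrite -sum_constR; apply: ler_sum => i _; exact: row_size_le. Qed.

Lemma pairs_through_col_le y : \sum_k ((c k == y)%:R + (d k == y)%:R) <= m.
Proof.
under eq_bigr do rewrite (eq_sym (c _)) (eq_sym (d _)).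
apply: le_trans (sum_pair_cells_le (g := fun _ j => (y == j)%:R) _) _ => //.
rewrite -[X in _ <= X%:R]sum1_card natr_sum; apply: ler_sum => i _.
rewrite -[X in _ <= X](sum_indicator R y); apply: ler_sum => j _.
by rewrite eq_sym; case: (O i j); rewrite ?mul1r ?mul0r.
Qed.

(** Pairs with a cell in column y are left out since C3 says nothing about them. *)
Definition pair_inside y k := [&& O (r k) y, O (s k) y, c k != y & d k != y].
Definition inside_ind y k : R := (pair_inside y k)%:R.
Definition num_inside y : R := \sum_k inside_ind y k.
Definition common y j : R := \sum_i o i y * o i j.
(** Among the incidences counted by common y j, those used by pairs inside y. *)
Definition matched y j : R := \sum_i load (inside_ind y) i j.
(** The slack in the counting inequality for column y, up to a term O(n). *)
Definition lack y : R := n * col_size y - \sum_i o i y * row_size i - 2 * num_inside y.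
Definition defect y j : R :=
  col_size y ^+ 2 - col_size y * common y j - 3 * col_size y * matched y j
  + 4 * common y j * matched y j.

Lemma inside_ind_le1 y k : inside_ind y k <= 1. Proof. by rewrite /inside_ind lern1 leq_b1. Qed.

Lemma load_inside_ge0 y i j : 0 <= load (inside_ind y) i j.
Proof. by apply: load_ge0. Qed.

Lemma load_inside_le y i j : load (inside_ind y) i j <= o i y * o i j.
Proof.
have [Oy|nOy] := boolP (O i y).
  rewrite mul1r; apply: le_trans (usage_le i j).
  by apply: load_le => k; exact: inside_ind_le1.
rewrite mul0r /load big1 // => k _; rewrite /inside_ind.
have [/and4P[Or Os _ _]|_] := boolP (pair_inside y k); last by rewrite mul0r.
case: (r k =P i) => [e|_]; first by rewrite e (negPf nOy) in Or.
case: (s k =P i) => [e|_]; first by rewrite e (negPf nOy) in Os.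
by rewrite addr0 mulr0.
Qed.

Lemma matched_ge0 y j : 0 <= matched y j.
Proof. by apply: sumr_ge0 => i _; exact: load_inside_ge0. Qed.

Lemma matched_le y j : matched y j <= common y j.
Proof. by apply: ler_sum => i _; exact: load_inside_le. Qed.

Lemma common_le y j : common y j <= col_size y.
Proof.
by apply: ler_sum => i _; case: (O i y); case: (O i j); rewrite ?mulr1 ?mulr0.
Qed.

Lemma sum_matched y : \sum_j matched y j = 2 * num_inside y.
Proof.
rewrite exchange_big /=.
have := sum_load (inside_ind y) (fun _ _ => 1).
under [X in _ = X -> _]eq_bigr do under eq_bigr do rewrite mulr1.
by move=> <-; rewrite -mulr_suml mulrC.
Qed.

Lemma sum_common y : \sum_j common y j = \sum_i o i y * row_size i.
Proof. by rewrite exchange_big /=; apply: eq_bigr => i _; rewrite mulr_sumr. Qed.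

(** By C3, the only rows through y that meet both columns of an inside pair are the
    two rows of the pair. *)
Lemma common_pair y k : pair_inside y k -> common y (c k) + common y (d k) <= col_size y + 2.
Proof.
case/and4P => Or Os cy dy; rewrite -lerBlDl -big_split -sumrB /=.
apply: (@le_trans _ _ (\sum_i ((i == r k)%:R + (i == s k)%:R))); last first.
  by rewrite big_split /= !sum_indicator.
apply: ler_sum => i _.
have [->|ir] := eqVneq i (r k).
  by rewrite Or; case: (O _ (c k)); case: (O _ (d k)); case: (_ == s k) => /=; lra.
have [->|is'] := eqVneq i (s k).
  by rewrite Os; case: (O _ (c k)); case: (O _ (d k)) => /=; lra.
have := pk.2 k i y ir is'; rewrite !(eq_sym y) => /(_ cy dy); rewrite Or Os.
by case: (O i y); case: (O i (c k)); case: (O i (d k)) => //= _; lra.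
Qed.

Lemma sum_common_matched y :
  \sum_j common y j * matched y j <= (col_size y + 2) * num_inside y.
Proof.
have -> : \sum_j common y j * matched y j =
    \sum_k inside_ind y k * (common y (c k) + common y (d k)).
  rewrite (sum_load (inside_ind y) (fun _ j => common y j)) exchange_big /=.
  by apply: eq_bigr => j _; rewrite mulr_sumr; apply: eq_bigr => i _; rewrite mulrC.
rewrite mulr_sumr; apply: ler_sum => k _; rewrite /inside_ind.
have [ik|_] := boolP (pair_inside y k); last by rewrite mul0r mulr0.
by rewrite mul1r mulr1 common_pair.
Qed.

Lemma defect_ge0 y j : 0 <= defect y j.
Proof.
have b0 := matched_ge0 y j; have ba := matched_le y j; have aN := common_le y j.
have N0 := le_trans (le_trans b0 ba) aN.
have [N_0|Np] := eqVneq (col_size y) 0.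
  rewrite /defect N_0; have := mulr_ge0 (le_trans b0 ba) b0; nra.
have {}Np : 0 < col_size y by rewrite lt_def Np.
rewrite -(pmulr_rge0 _ Np); apply: le_trans (defect_ineq b0 ba aN).
exact: defect_weight_ge0.
Qed.

(** The term 4 * common * matched of the defect is where common_pair enters: it
    sums to at most 4 (col_size y + 2) per inside pair. *)
Lemma sum_defect_le y : \sum_j defect y j <= col_size y * lack y + 8 * num_inside y.
Proof.
have h := sum_common_matched y.
rewrite /defect !big_split /= sumr_const -[_ *+ _]mulr_natr.
rewrite !sumrN -!mulr_sumr sum_matched sum_common.
have -> : \sum_j 4 * common y j * matched y j = 4 * \sum_j common y j * matched y j.
  by rewrite mulr_sumr; apply: eq_bigr => j _; ring.
rewrite /lack; move: h; set X := \sum_j _; set Y := \sum_i _ => h.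
nra.
Qed.

Lemma num_inside_le y : 2 * num_inside y <= n * col_size y.
Proof.
rewrite -sum_matched mulr_natl -sumr_const; apply: ler_sum => j _.
exact: le_trans (matched_le y j) (common_le y j).
Qed.

Lemma sum_defect_lack y : \sum_j defect y j <= col_size y * (lack y + 4 * n).
Proof.
apply: le_trans (sum_defect_le y) _; have := num_inside_le y; nra.
Qed.

(** The counting inequality for one column: up to O(n), col_size y times the lack of
    y is at least the sum of the defects, which are nonnegative. *)
Lemma lack_ge y : 0 <= lack y + 4 * n.
Proof.
have := sum_defect_lack y.
have : 0 <= \sum_j defect y j by apply: sumr_ge0 => j _; exact: defect_ge0.
have [N_0|Np] := eqVneq (col_size y) 0.
  have E0 := num_inside_le y; rewrite N_0 mulr0 in E0.
  have : \sum_i o i y * row_size i <= 0.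
    rewrite -sum_common; apply: sumr_le0 => j _; rewrite -N_0; exact: common_le.
  have n0 : 0 <= n by [].
  by rewrite /lack N_0; lra.
have {}Np : 0 < col_size y by rewrite lt_def Np col_size_ge0.
by move=> h1 h2; rewrite -(pmulr_rge0 _ Np) (le_trans h1 h2).
Qed.

Lemma sum_num_inside :
  \sum_k (row_size (r k) + row_size (s k)) - (n + 2) * #|K|%:R <= \sum_y num_inside y.
Proof.
rewrite [X in _ <= X]exchange_big /= mulr_natr -sumr_const -sumrB.
apply: ler_sum => k _.
rewrite -big_split /= (_ : n + 2 = \sum_y (1 + (c k == y)%:R + (d k == y)%:R)).
  rewrite -sumrB; apply: ler_sum => y _; rewrite /inside_ind /pair_inside.
  by case: (O _ y); case: (O _ y); case: (_ == y); case: (_ == y); rewrite /=; lra.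
rewrite !big_split /= sumr_const.
under [X in _ = _ + X + _]eq_bigr do rewrite eq_sym.
under [X in _ = _ + _ + X]eq_bigr do rewrite eq_sym.
by rewrite !sum_indicator; ring.
Qed.

Lemma sum_pair_rows :
  \sum_i row_size i ^+ 2 - n * unpaired <= \sum_k (row_size (r k) + row_size (s k)).
Proof.
rewrite (sum_pair_cells (fun i _ => row_size i)) /unpaired mulr_sumr -sumrB.
apply: ler_sum => i _; rewrite expr2 {1}/row_size mulr_suml mulr_sumr -sumrB.
apply: ler_sum => j _.
have := usage_le i j; have := row_size_le i; nra.
Qed.

(** Summing the counting inequality over all columns.  A pair is inside at least
    row_size (r k) + row_size (s k) - n - 2 columns, so the sum contains the
    squares of the row sizes three times; completing the square around 2n/3 leaves
    the deficit of total from 2mn/3 on the right. *)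
Lemma sum_lack :
  3 * \sum_i (row_size i - 2 * n / 3) ^+ 2 + \sum_y lack y
  <= 2 * n * ((2 * m * n / 3 - total) + m + unpaired).
Proof.
have h1 := sum_num_inside; have h2 := sum_pair_rows.
have h3 := double_pairs.
have h4 := total_le.
have u0 := unpaired_ge0.
rewrite /lack !big_split /= !sumrN -!mulr_sumr -total_col.
have -> : \sum_y \sum_i o i y * row_size i = \sum_i row_size i ^+ 2.
  rewrite exchange_big; apply: eq_bigr => i _ /=.
  by rewrite -mulr_suml expr2.
have -> : \sum_i (row_size i - 2 * n / 3) ^+ 2 =
    \sum_i row_size i ^+ 2 - 4 * n / 3 * total + 4 * n ^+ 2 / 9 * m.
  under eq_bigr do rewrite sqrrB.
  rewrite !big_split /= sumr_const -[_ *+ _]mulr_natr sumrN /total mulr_sumr.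
  congr (_ - _ + _); last by field.
  by apply: eq_bigr => i _; rewrite -mulr_natr; field.
move: h1 h2 h3 h4 u0.
set Q := \sum_i _ ^+ 2; set T := total; set U := unpaired.
set P := \sum_k (_ + _); set E := \sum_y _; set k := #|K|%:R.
move=> h1 h2 h3 h4 u0.
have n0 : 0 <= n by [].
have : (n + 2) * (2 * k) <= (n + 2) * T by rewrite ler_wpM2l ?addr_ge0 // h3; lra.
nra.
Qed.

(** Here the number of inside pairs in lack_ge is bounded below in terms of the
    rows through y only: a pair with weight o (r k) y + o (s k) y - 1 > 0 is
    inside y.  The rows through y are thus small on average when column y is
    not large. *)
Lemma sum_rows_through_le y :
  3 * \sum_i o i y * row_size i
  <= n * col_size y + total + 2 * unpaired + 2 * m + 4 * n.
Proof.
have := lack_ge y; rewrite /lack.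
have h3 := double_pairs.
have u0 := unpaired_ge0.
have h1 : \sum_k (o (r k) y + o (s k) y) - #|K|%:R - m <= num_inside y.
  have hm := pairs_through_col_le y.
  apply: le_trans (_ : \sum_k (o (r k) y + o (s k) y - 1 - ((c k == y)%:R + (d k == y)%:R)) <= _).
    rewrite !big_split /= !sumrN sumr_const; move: hm; rewrite big_split /=; lra.
  apply: ler_sum => k _; rewrite /inside_ind /pair_inside.
  by case: (O _ y); case: (O _ y); case: (_ == y); case: (_ == y); rewrite /=; lra.
have h2 : \sum_i o i y * row_size i - unpaired <= \sum_k (o (r k) y + o (s k) y).
  rewrite (sum_pair_cells (fun i _ => o i y)) /unpaired -sumrB.
  apply: ler_sum => i _; rewrite /row_size mulr_sumr -sumrB.
  apply: ler_sum => j _; have := usage_le i j.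
  by case: (O i y); rewrite ?mul1r ?mul0r ?mulr1 ?mulr0; lra.
move: h1 h2 h3 u0; set S := \sum_i _; set P := \sum_k _; set k := #|K|%:R; lra.
Qed.

Variable h : I -> R.
Hypothesis h1 : forall i, `|h i| <= 1.

Definition spread : R := \sum_i (row_size i - 2 * n / 3) ^+ 2.
(** The function h is meant to be a sign that splits the rows into two classes;
    bias y compares the two classes in column y and skew y counts, with signs,
    the inside pairs whose rows lie in the same class. *)
Definition bias y : R := \sum_i h i * o i y.
Definition skew y : R := \sum_k inside_ind y k * (h (r k) + h (s k)).

Lemma bias_le y : `|bias y| <= col_size y.
Proof.
apply: le_trans (ler_norm_sum _ _ _) _; apply: ler_sum => i _.
by case: (O i y); rewrite ?mulr1 ?mulr0 ?normr0.
Qed.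

Lemma sum_dev_sqr (g : I -> R) : (forall i, `|g i| <= 1) ->
  (\sum_i g i * (row_size i - 2 * n / 3)) ^+ 2 <= m * spread.
Proof.
move=> g1; apply: le_trans (sqr_sum_le _) _; rewrite ler_wpM2l //.
apply: ler_sum => i _; rewrite exprMn -[X in _ <= X]mul1r ler_wpM2r ?sqr_ge0 //.
by rewrite -[X in _ <= X](expr1n _ 2); apply: sqr_abs_le.
Qed.

(** If nearly all pairs join the two classes, every column is split evenly.  In an
    extremal configuration the columns are, with respect to y, of two kinds:
    those with (common, matched) = (N, 0) and those with (N/2, N/2).  Hence each
    row through y has n/3 cells in inside pairs, whichever class it belongs to,
    and pairs joining the classes make the two classes equally large in y.  The
    terms t j below measure the distance from this situation; defect_sqr bounds
    them by the defect. *)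
Lemma discrepancy y :
  n ^+ 2 / 9 * bias y ^+ 2
  <= 4 * skew y ^+ 2 + 20 * (m * spread) + 72 * (n * m * (lack y + 4 * n)).
Proof.
set N := col_size y; set D := bias y; set L := lack y + 4 * n.
have N0 : 0 <= N by exact: col_size_ge0.
have L0 : 0 <= L by exact: lack_ge.
have n0 : 0 <= n by []. have m0 : 0 <= m by [].
have T0 : 0 <= spread by apply: sumr_ge0 => i _; exact: sqr_ge0.
have [N_0|Np] := eqVneq N 0.
  have := bias_le y; rewrite -/N -/D N_0 normr_le0 => /eqP ->.
  rewrite expr0n mulr0; apply: addr_ge0; first apply: addr_ge0.
  - by rewrite (pmulr_rge0 _ (ltr0n _ 4)) sqr_ge0.
  - by rewrite !mulr_ge0.
  - by rewrite !mulr_ge0.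
have {}Np : 0 < N by rewrite lt_def Np.
pose lh j := \sum_i h i * (o i y * o i j).
pose mh j := \sum_i h i * load (inside_ind y) i j.
pose t j := (D - lh j) * (2 * common y j - N) + mh j * (2 * common y j - N)
            - 2 * (lh j - mh j) * (N - common y j).
(* D - lh j, mh j and lh j - mh j are the signed versions of N - common, matched
   and common - matched. *)
have t_le j : t j ^+ 2 <= 18 * (N ^+ 2 * defect y j).
  apply: defect_sqr.
  - exact: matched_ge0.
  - exact: matched_le.
  - exact: common_le.
  - rewrite /lh /mh -sumrB /common /matched -sumrB.
    apply: le_trans (ler_norm_sum _ _ _) _; apply: ler_sum => i _.
    by rewrite -mulrBr norm_mul_le // subr_ge0 load_inside_le.
  - rewrite /D /bias /lh /N -sumrB /common -sumrB.
    apply: le_trans (ler_norm_sum _ _ _) _; apply: ler_sum => i _.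
    rewrite -mulrBr norm_mul_le // subr_ge0.
    by case: (O i y); case: (O i j); rewrite ?mulr1 ?mulr0.
  - apply: le_trans (ler_norm_sum _ _ _) _; apply: ler_sum => i _.
    by rewrite norm_mul_le // load_inside_ge0.
have st : (\sum_j t j) ^+ 2 <= N ^+ 2 * (18 * (n * m * L)).
  apply: le_trans (sqr_sum_le _) _.
  have e1 : \sum_j t j ^+ 2 <= 18 * (N ^+ 2 * (N * L)).
    apply: le_trans (_ : \sum_j 18 * (N ^+ 2 * defect y j) <= _).
      by apply: ler_sum => j _; exact: t_le.
    rewrite -!mulr_sumr !ler_wpM2l ?sqr_ge0 //; exact: sum_defect_lack.
  have e2 : N * L <= m * L by rewrite ler_wpM2r // col_size_le.
  apply: le_trans (_ : n * (18 * (N ^+ 2 * (m * L))) <= _).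
    rewrite ler_wpM2l // (le_trans e1) // !ler_wpM2l ?sqr_ge0 //.
  by rewrite le_eqVlt; apply/orP; left; apply/eqP; ring.
pose Hd := \sum_i (h i * o i y) * (row_size i - 2 * n / 3).
pose Sd := \sum_i o i y * (row_size i - 2 * n / 3).
have Hd2 : Hd ^+ 2 <= m * spread.
  apply: sum_dev_sqr => i; rewrite normrM.
  by case: (O i y); rewrite ?normr1 ?mulr1 ?normr0 ?mulr0.
have Sd2 : Sd ^+ 2 <= m * spread.
  by apply: sum_dev_sqr => i; case: (O i y); rewrite ?normr1 ?normr0.
have key : \sum_j t j = N * (skew y - Hd - n / 3 * D) + 2 * D * Sd.
  have -> : \sum_j t j = N * (\sum_j mh j - \sum_j lh j) + D * (2 * \sum_j common y j - n * N).
    have -> : n * N = \sum_(j : J) N by rewrite sumr_const mulr_natl.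
    rewrite -sumrB [2 * _]mulr_sumr -sumrB !mulr_sumr -big_split.
    by apply: eq_bigr => j _; rewrite /t /=; ring.
  have -> : \sum_j mh j = skew y.
    rewrite /skew (sum_load (inside_ind y) (fun i _ => h i)) exchange_big /=.
    by apply: eq_bigr => i _; apply: eq_bigr => j _; rewrite mulrC.
  have -> : \sum_j lh j = Hd + 2 * n / 3 * D.
    rewrite /lh exchange_big /Hd /D /bias mulr_sumr -big_split /=.
    apply: eq_bigr => i _; rewrite -!mulr_sumr -/(row_size i); ring.
  have -> : \sum_j common y j = Sd + 2 * n / 3 * N.
    rewrite sum_common /Sd /N /col_size mulr_sumr -big_split /=.
    apply: eq_bigr => i _; ring.
  by field.
have D2 : D ^+ 2 <= N ^+ 2 by apply: sqr_abs_le; exact: bias_le.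
rewrite -(ler_pM2l (exprn_gt0 2 Np)).
move: key st => ->; move: D2 Hd2 Sd2; set W := skew y; set mT := m * spread; set q := n * m * L.
move=> D2 Hd2 Sd2 st.
have e1 : N ^+ 2 * Hd ^+ 2 <= N ^+ 2 * mT by rewrite ler_wpM2l ?sqr_ge0.
have e2 : D ^+ 2 * Sd ^+ 2 <= N ^+ 2 * mT by rewrite ler_pM ?sqr_ge0.
set t0 := N * (W - Hd - n / 3 * D) + 2 * D * Sd in st.
have -> : N ^+ 2 * (n ^+ 2 / 9 * D ^+ 2) = (N * W + - (N * Hd) + 2 * D * Sd + - t0) ^+ 2.
  by rewrite /t0; field.
(* Each of the four summands carries a factor N or is bounded by N times
   something, since |D| <= N. *)
have four (x1 x2 x3 x4 : R) :
  (x1 + x2 + x3 + x4) ^+ 2 <= 4 * (x1 ^+ 2 + x2 ^+ 2 + x3 ^+ 2 + x4 ^+ 2).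
  have := sqr_ge0 (x1 - x2); have := sqr_ge0 (x1 - x3); have := sqr_ge0 (x1 - x4).
  have := sqr_ge0 (x2 - x3); have := sqr_ge0 (x2 - x4); have := sqr_ge0 (x3 - x4); lra.
apply: le_trans (four _ _ _ _) _; rewrite !sqrrN !exprMn.
move: e1 e2 st; clear; set t2 := t0 ^+ 2; lra.
Qed.

End Packing.

(** * Packings with an anchor column *)

(** The hypothesis few_off_anchor holds when the rows that miss y0 contain
    distinct column pairs; it is stated for all sets W of columns because the
    rows in question are also required to avoid given columns. *)
Section Anchor.
Local Open Scope ring_scope.
Variables (R : realFieldType) (I J K : finType) (O : I -> J -> bool).
Variables (r s : K -> I) (c d : K -> J).
Hypothesis pk : packing O r s c d.
Variable y0 : J.

Notation o i j := ((O i j)%:R : R).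
Notation us i j := ((usage r s c d i j)%:R : R).
Notation m := (#|I|%:R : R).
Notation n := (#|J|%:R : R).
Notation row := (row_size R O).
Notation col := (col_size R O).
Notation lackO := (lack R O r s c d).
Notation inside_ind := (inside_ind R O r s c d).
Notation unpairedO := (unpaired R O r s c d).
Notation T := (spread R O).

Hypothesis n2m : (#|J| ^ 2 <= #|I|)%N.
Hypothesis unp : unpairedO <= 2 * m.
Hypothesis few_off_anchor : forall W : {set J},
  (#|[set i | ~~ O i y0 & [forall j, O i j ==> (j \in W)]]| <= 'C(#|W|, 2))%N.

Definition deficit : R := 2 * m * n / 3 - total R O.
(** The constant 6 makes slack at least m, so that slack absorbs all error terms of
    order m. *)
Definition slack : R := deficit + 6 * m.
Definition col_spread : R := spread R (transpose O).
(* T and Q are the square deviations of the row and column sizes, th and ph the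
   deviations themselves. *)
Notation Q := col_spread.
Notation S := slack.
Notation th i := (row i - 2 * n / 3).
Notation ph j := (col j - 2 * m / 3).

Lemma n_gt0 : 0 < n. Proof. by rewrite ltr0n; apply/card_gt0P; exists y0. Qed.
Lemma nn_le_m : n ^+ 2 <= m. Proof. by rewrite -natrX ler_nat. Qed.
Lemma n_le_m : n <= m.
Proof.
by apply: le_trans nn_le_m; rewrite -natrX ler_nat -mulnn; case: #|J| => // k; rewrite leq_pmulr.
Qed.
Lemma m_gt0 : 0 < m. Proof. exact: lt_le_trans n_gt0 n_le_m. Qed.

Lemma unpaired_transpose : unpaired R (transpose O) c d r s = unpairedO.
Proof.
rewrite /unpaired exchange_big; apply: eq_bigr => i _; apply: eq_bigr => j _.
congr (_ - _%:R); rewrite /usage; congr (_ + _)%N; apply: eq_bigr => k _; exact: congr1 (andbC _ _).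
Qed.

Lemma col_spreadE : Q = \sum_j ph j ^+ 2. Proof. by []. Qed.

Lemma spread_ge0 : 0 <= T. Proof. by apply: sumr_ge0 => i _; exact: sqr_ge0. Qed.

Lemma sum_lack_spread : 3 * T + \sum_y (lackO y + 4 * n) <= 2 * n * (deficit + 5 * m).
Proof.
have := sum_lack R pk; rewrite -/(spread R O) => h.
rewrite big_split /= sum_constR.
have e : 2 * n * unpairedO <= 2 * n * (2 * m) by rewrite ler_wpM2l ?mulr_ge0.
have e2 : n * n <= n * m by rewrite ler_wpM2l // n_le_m.
by move: h e e2; rewrite /deficit; nra.
Qed.

Lemma spread_le_deficit : 3 * T <= 2 * n * (deficit + 5 * m).
Proof.
apply: le_trans sum_lack_spread; rewrite lerDl; apply: sumr_ge0 => y _; exact: lack_ge.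
Qed.

Lemma m_le_slack : m <= S.
Proof.
have := le_trans (mulr_ge0 (ler0n R 3) spread_ge0) spread_le_deficit.
by rewrite pmulr_rge0 ?mulr_gt0 ?n_gt0 // /slack; lra.
Qed.

Lemma spread_le : 3 * T <= 2 * n * S.
Proof.
apply: le_trans spread_le_deficit _; rewrite ler_wpM2l ?mulr_ge0 // /slack.
by have := m_gt0; lra.
Qed.

Lemma sum_lack_le : \sum_y (lackO y + 4 * n) <= 2 * n * S.
Proof.
have h := sum_lack_spread; have h2 := spread_ge0.
apply: le_trans (_ : _ <= 2 * n * (deficit + 5 * m)) _; first lra.
rewrite ler_wpM2l ?mulr_ge0 // /slack; have := m_gt0; lra.
Qed.

Lemma col_spread_le : 3 * Q <= 2 * m * S.
Proof.
have pk' := packing_transpose pk.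
have := sum_lack R pk'; rewrite -/(spread R (transpose O)) -/Q.
have -> : total R (transpose O) = total R O by rewrite total_col.
rewrite unpaired_transpose => h.
have l0 : - (4 * m * m) <= \sum_y lack R (transpose O) c d r s y.
  apply: le_trans (_ : \sum_(i : I) - (4 * m) <= _).
    by rewrite sum_constR; lra.
  by apply: ler_sum => i _; have := lack_ge R pk' i; lra.
have e : 2 * m * unpairedO <= 2 * m * (2 * m) by rewrite ler_wpM2l ?mulr_ge0.
have e2 : m * n <= m * m by rewrite ler_wpM2l // n_le_m.
by move: h l0 e e2; rewrite /slack /deficit; nra.
Qed.

Definition anchored_pairs : R := \sum_k o (r k) y0 * o (s k) y0.

Lemma anchored_pairs_ge0 : 0 <= anchored_pairs.
Proof. by apply: sumr_ge0 => k _; rewrite mulr_ge0. Qed.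

Lemma pairs_le : 2 * #|K|%:R <= m * n.
Proof.
rewrite (double_pairs R O r s c d).
by have := unpaired_ge0 R pk; have := total_le R O; lra.
Qed.

Lemma anchored_pairs_le_card : anchored_pairs <= #|K|%:R.
Proof.
rewrite -sum1_card natr_sum; apply: ler_sum => k _.
by case: (O _ _); case: (O _ _); rewrite ?mulr1 ?mulr0.
Qed.

(** C3 with y = y0 shows that a further row through both columns of an anchored pair
    misses y0; C3 for the other columns y confines it to the columns not common
    to the two rows of the pair.  Here w is the number of columns left. *)
Lemma common_rows_le k : pair_inside O r s c d y0 k ->
  exists2 w : nat, w%:R <= 2 * n + 2 - row (r k) - row (s k)
    & col (c k) + col (d k) - m <= 2 + ('C(w, 2))%:R.
Proof.
case/and4P => Or Os cy dy.
pose W := [set j | [|| ~~ (O (r k) j && O (s k) j), j == c k | j == d k]].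
exists #|W|.
  rewrite -sum_mem.
  have -> : 2 * n + 2 - row (r k) - row (s k) =
     \sum_j (2 - o (r k) j - o (s k) j + (j == c k)%:R + (j == d k)%:R).
    rewrite !big_split /= !sumrN sum_constR !sum_indicator /row_size; ring.
  apply: ler_sum => j _; rewrite inE.
  by case: (O _ j); case: (O _ j); case: (j == c k); case: (j == d k) => /=; lra.
apply: le_trans (_ : \sum_i ((i == r k)%:R + (i == s k)%:R + (i \in
    [set i | ~~ O i y0 & [forall j, O i j ==> (j \in W)]])%:R) <= _); last first.
  by rewrite !big_split /= !sum_indicator sum_mem lerD // ler_nat few_off_anchor.
rewrite -sum1_card natr_sum -big_split -sumrB /=; apply: ler_sum => i _.
have [->|ir] := eqVneq i (r k).
  by case: (O _ (c k)); case: (O _ (d k)); case: (_ == s k); case: (_ \in _) => /=; lra.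
have [->|is'] := eqVneq i (s k).
  by case: (O _ (c k)); case: (O _ (d k)); case: (_ \in _) => /=; lra.
case Oc: (O i (c k)); case Od: (O i (d k)) => /=; try by case: (_ \in _) => /=; lra.
suff -> : i \in [set i | ~~ O i y0 & [forall j, O i j ==> (j \in W)]] by rewrite /=; lra.
have H y := pk.2 k i y ir is'.
rewrite inE; apply/andP; split.
  have := H y0; rewrite !(eq_sym y0) => /(_ cy dy); rewrite Oc Od Or Os.
  by case: (O i y0).
apply/forallP => j; apply/implyP => Oj; rewrite inE.
have [//|jc] := eqVneq j (c k); first by rewrite orbT.
have [//|jd] := eqVneq j (d k); first by rewrite !orbT.
by have := H j jc jd; rewrite Oc Od Oj /= !orbF.
Qed.

(** If the two row sizes add up to more than (4/3 - 1/30) n and the two column sizes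
    to more than (4/3 - 1/30) m, then w <= 7n/10 + 2 and 'C(w, 2) is about
    0.245 n ^ 2, which is less than the 3m/10 common rows required. *)
Lemma deviant_pair k : (30 <= #|J|)%N -> pair_inside O r s c d y0 k ->
  n ^+ 2 * m ^+ 2 <= 1800 * m ^+ 2 * (th (r k) ^+ 2 + th (s k) ^+ 2)
                  + 1800 * n ^+ 2 * (ph (c k) ^+ 2 + ph (d k) ^+ 2).
Proof.
move=> n30 ik.
have [w hw hC] := common_rows_le ik.
set x1 := th (r k); set x2 := th (s k); set z1 := ph (c k); set z2 := ph (d k).
have m20 := sqr_ge0 m; have n20 := sqr_ge0 n.
have a1 := addr_ge0 (sqr_ge0 x1) (sqr_ge0 x2).
have a2 := addr_ge0 (sqr_ge0 z1) (sqr_ge0 z2).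
have [hx|hx] := leP (n ^+ 2) (900 * (x1 + x2) ^+ 2).
  have e : n ^+ 2 <= 1800 * (x1 ^+ 2 + x2 ^+ 2) by have := sqr_ge0 (x1 - x2); nra.
  have := ler_wpM2l m20 e; have := mulr_ge0 n20 a2; lra.
have [hz|hz] := leP (m ^+ 2) (900 * (z1 + z2) ^+ 2).
  have e : m ^+ 2 <= 1800 * (z1 ^+ 2 + z2 ^+ 2) by have := sqr_ge0 (z1 - z2); nra.
  have := ler_wpM2l n20 e; have := mulr_ge0 m20 a1; lra.
exfalso.
have hx' : - n < 30 * (x1 + x2).
  rewrite ltNge; apply/negP => h; have := n_gt0; nra.
have hz' : - m < 30 * (z1 + z2).
  rewrite ltNge; apply/negP => h; have := m_gt0; nra.
have w2 : 2 * ('C(w, 2))%:R <= w%:R ^+ 2 :> R.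
  by rewrite -natrX -natrM ler_nat double_bin2_le.
have wlt : w%:R <= 7 / 10 * n + 2.
  by apply: le_trans hw _; move: hx'; rewrite /x1 /x2; lra.
have w3 : w%:R ^+ 2 <= (7 / 10 * n + 2) ^+ 2 by rewrite lerXn2r ?nnegrE // (le_trans _ wlt).
have c1 : 3 / 10 * m < col (c k) + col (d k) - m by move: hz'; rewrite /z1 /z2; lra.
have nn := nn_le_m.
have n30' : 30 <= n by rewrite (ler_nat R 30).
have nn30 : 30 * n <= n ^+ 2 by rewrite expr2 ler_wpM2r.
lra.
Qed.

Lemma sum_pairs_row_sqr : \sum_k (th (r k) ^+ 2 + th (s k) ^+ 2) <= n * T.
Proof.
apply: le_trans (sum_pair_cells_le pk (g := fun i _ => th i ^+ 2) _) _.
  by move=> i j; exact: sqr_ge0.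
rewrite /spread mulr_sumr; apply: ler_sum => i _.
by rewrite -mulr_suml ler_wpM2r ?sqr_ge0 // row_size_le.
Qed.

Lemma sum_pairs_col_sqr : \sum_k (ph (c k) ^+ 2 + ph (d k) ^+ 2) <= m * Q.
Proof.
apply: le_trans (sum_pair_cells_le pk (g := fun _ j => ph j ^+ 2) _) _.
  by move=> i j; exact: sqr_ge0.
rewrite col_spreadE mulr_sumr exchange_big; apply: ler_sum => j _ /=.
by rewrite -mulr_suml ler_wpM2r ?sqr_ge0 // col_size_le.
Qed.

(** Every anchored pair is deviant, and the sums of squares bound the number of
    deviant pairs.  The pairs with a cell in column y0 are at most m, and for
    n < 30 the trivial bound by mn/2 suffices. *)
Lemma anchored_pairs_le : anchored_pairs <= 2416 * S.
Proof.
have mS := m_le_slack; have m0 := m_gt0; have n0 := n_gt0.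
have [n30|n30] := leqP 30 #|J|; last first.
  have := anchored_pairs_le_card; have := pairs_le.
  have : m * n <= m * 30 by rewrite ler_wpM2l // (ler_nat R _ 30) ltnW.
  lra.
have h1 := pairs_through_col_le R pk y0.
have h2 : anchored_pairs <= m + num_inside R O r s c d y0.
  apply: le_trans (lerD h1 (lexx _)); rewrite /num_inside -big_split /=.
  apply: ler_sum => k _; rewrite /inside_ind /pair_inside.
  by case: (O _ y0); case: (O _ y0); case: (c k == y0); case: (d k == y0) => /=; lra.
have h3 : n ^+ 2 * m ^+ 2 * num_inside R O r s c d y0 <= 2400 * (n ^+ 2 * m ^+ 2 * S).
  apply: le_trans (_ : \sum_k (1800 * m ^+ 2 * (th (r k) ^+ 2 + th (s k) ^+ 2)
                  + 1800 * n ^+ 2 * (ph (c k) ^+ 2 + ph (d k) ^+ 2)) <= _).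
    rewrite /num_inside mulr_sumr; apply: ler_sum => k _; rewrite /inside_ind.
    have [ik|_] := boolP (pair_inside O r s c d y0 k); first by rewrite mulr1 deviant_pair.
    rewrite mulr0 addr_ge0 // mulr_ge0 ?addr_ge0 ?sqr_ge0 //.
      by rewrite mulr_ge0 ?sqr_ge0.
    by rewrite mulr_ge0 ?sqr_ge0.
  rewrite big_split /= -!mulr_sumr.
  have e1 := ler_wpM2l (sqr_ge0 m) sum_pairs_row_sqr.
  have e2 := ler_wpM2l (sqr_ge0 n) sum_pairs_col_sqr.
  have e3 := ler_wpM2l (mulr_ge0 (sqr_ge0 m) (ltW n0)) spread_le.
  have e4 := ler_wpM2l (mulr_ge0 (sqr_ge0 n) (ltW m0)) col_spread_le.
  move: e1 e2 e3 e4; set X := \sum_k _; set Y := \sum_k _; lra.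
have p0 : 0 < n ^+ 2 * m ^+ 2 by rewrite mulr_gt0 ?exprn_gt0.
have h4 : num_inside R O r s c d y0 <= 2400 * S.
  rewrite -(ler_pM2l p0); apply: le_trans h3 _.
  by rewrite le_eqVlt; apply/orP; left; apply/eqP; ring.
lra.
Qed.

Definition anchor_sign i : R := 2 * o i y0 - 1.
Definition off_anchor i : R := 1 - o i y0.
Notation bias := (bias O anchor_sign).
Notation skew := (skew O r s c d anchor_sign).

Lemma anchor_sign_le1 i : `|anchor_sign i| <= 1.
Proof.
by rewrite /anchor_sign; case: (O i y0); rewrite ler_norml; apply/andP; split => /=; lra.
Qed.

Lemma off_anchor_ge0 i : 0 <= off_anchor i.
Proof. by rewrite /off_anchor; case: (O i y0) => /=; lra. Qed.
Lemma off_anchor_le1 i : off_anchor i <= 1.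
Proof. by rewrite /off_anchor; case: (O i y0) => /=; lra. Qed.

(** The rows that miss y0 are confined to the n - 1 other columns. *)
Lemma sum_off_anchor_le : 2 * \sum_i off_anchor i <= n ^+ 2.
Proof.
have := few_off_anchor (~: [set y0]).
have e : #|~: [set y0]| = (#|J| - 1)%N by have := cardsC [set y0]; rewrite cards1; lia.
rewrite e => h.
have -> : \sum_i off_anchor i =
    #|[set i | ~~ O i y0 & [forall j, O i j ==> (j \in ~: [set y0])]]|%:R.
  rewrite -sum_mem; apply: eq_bigr => i _; rewrite inE /off_anchor.
  have [Oy|nOy] := boolP (O i y0); first by rewrite subrr.
  rewrite subr0 /= (_ : [forall j, _] = true) //.
  apply/forallP => j; apply/implyP => Oj; rewrite !inE; apply: contraNneq nOy => <- //.
apply: le_trans (_ : 2 * ('C(#|J| - 1, 2))%:R <= _); first by rewrite ler_wpM2l // ler_nat.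
by rewrite -natrX -natrM ler_nat (leq_trans (double_bin2_le _)) // leq_sqr leq_subr.
Qed.

Lemma sum_pairs_sign :
  \sum_k (anchor_sign (r k) + anchor_sign (s k)) >= - (2 * m) + \sum_i anchor_sign i * th i.
Proof.
rewrite (sum_pair_cells r s c d (fun i _ => anchor_sign i)).
have h0 : 0 <= \sum_i anchor_sign i.
  have -> : \sum_i anchor_sign i = m - 2 * \sum_i off_anchor i.
    rewrite mulr_sumr -[m]mulr1 -sum_constR -sumrB; apply: eq_bigr => i _.
    by rewrite /anchor_sign /off_anchor; ring.
  by have := sum_off_anchor_le; have := nn_le_m; lra.
have h1 : \sum_i anchor_sign i * row i - unpairedO <= \sum_i \sum_j us i j * anchor_sign i.
  rewrite -sumrB; apply: ler_sum => i _.
  rewrite {1}/row_size mulr_sumr -sumrB; apply: ler_sum => j _.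
  have := usage_le R pk i j; have := anchor_sign_le1 i; rewrite ler_norml => /andP[]; nra.
have -> : \sum_i anchor_sign i * th i =
    \sum_i anchor_sign i * row i - 2 * n / 3 * \sum_i anchor_sign i.
  by rewrite mulr_sumr -sumrB; apply: eq_bigr => i _; ring.
have : 0 <= 2 * n / 3 * \sum_i anchor_sign i by rewrite mulr_ge0 // divr_ge0 // mulr_ge0.
have := unp; lra.
Qed.

Definition unmixed_pairs : R := anchored_pairs + \sum_k off_anchor (r k) * off_anchor (s k).

Lemma unmixed_pairs_ge0 : 0 <= unmixed_pairs.
Proof.
rewrite addr_ge0 ?anchored_pairs_ge0 // sumr_ge0 // => k _; by rewrite mulr_ge0 ?off_anchor_ge0.
Qed.

(** Few pairs are anchored, and the rows off y0 are not more numerous than the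
    others, so they cannot have many more cells unless the row sizes deviate from
    2n/3; this limits the pairs with both rows off y0.  That limit is only of
    square-root type, but the square is all that is needed. *)
Lemma unmixed_pairs_sqr : unmixed_pairs ^+ 2 <= 14600 * (m * n * S).
Proof.
have mS := m_le_slack; have m0 := m_gt0; have n0 := n_gt0.
have S0 : 0 <= S by rewrite (le_trans _ mS) // ltW.
have n1 : 1 <= n by rewrite (ler_nat R 1) -(ltr_nat R).
set H := \sum_i anchor_sign i * th i.
have H2 : H ^+ 2 <= m * T by apply: sum_dev_sqr; exact: anchor_sign_le1.
have TS := spread_le.
have E0 := anchored_pairs_ge0.
have ES : anchored_pairs <= 2416 * S by exact: anchored_pairs_le.
have EK := anchored_pairs_le_card.
have KK := pairs_le.
have h : unmixed_pairs <= 2 * anchored_pairs + m - H / 2.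
  have := sum_pairs_sign; rewrite -/H /unmixed_pairs.
  have -> : \sum_k off_anchor (r k) * off_anchor (s k) =
      anchored_pairs - (\sum_k (anchor_sign (r k) + anchor_sign (s k))) / 2.
    rewrite /anchored_pairs mulr_suml -sumrB; apply: eq_bigr => k _.
    by rewrite /off_anchor /anchor_sign; field.
  lra.
have M0 := unmixed_pairs_ge0.
have h2 : unmixed_pairs ^+ 2 <= (2 * anchored_pairs + m - H / 2) ^+ 2.
  by rewrite lerXn2r ?nnegrE // (le_trans M0).
apply: le_trans h2 _.
have h3 : (2 * anchored_pairs + m - H / 2) ^+ 2 <=
    3 * (4 * anchored_pairs ^+ 2 + m ^+ 2 + H ^+ 2 / 4).
  have := sqr_ge0 (2 * anchored_pairs - m).
  have := sqr_ge0 (2 * anchored_pairs + H / 2); have := sqr_ge0 (m + H / 2).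
  lra.
apply: le_trans h3 _.
have q0 : 0 <= m * n by rewrite mulr_ge0 // ltW.
have a1 : anchored_pairs ^+ 2 <= 1208 * (m * n * S).
  have : anchored_pairs * (2 * anchored_pairs) <= (2416 * S) * (m * n).
      by rewrite ler_pM // ?mulr_ge0 //; lra.
  lra.
have a2 : m ^+ 2 <= m * n * S.
  rewrite expr2 -mulrA ler_wpM2l //.
  by rewrite -[X in X <= _]mul1r ler_pM.
have a3 : H ^+ 2 <= 2 / 3 * (m * n * S).
  apply: le_trans H2 _; have := ler_wpM2l (ltW m0) TS; lra.
have q1 : 0 <= m * n * S by rewrite mulr_ge0.
lra.
Qed.

Lemma skew_le y : `|skew y| <= 2 * unmixed_pairs.
Proof.
apply: le_trans (ler_norm_sum _ _ _) _.
rewrite /unmixed_pairs /anchored_pairs -big_split mulr_sumr; apply: ler_sum => k _ /=.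
rewrite /inside_ind /anchor_sign /off_anchor.
case: (pair_inside _ _ _ _ _ _ _); case: (O (r k) y0); case: (O (s k) y0);
  rewrite ler_norml; apply/andP; split => /=; lra.
Qed.

Lemma sum_bias_sqr : \sum_y bias y ^+ 2 <= 2110 * 1000 * (m * S).
Proof.
have m0 := m_gt0; have n0 := n_gt0.
have TS := spread_le.
have LS := sum_lack_le.
have G := unmixed_pairs_sqr.
have h : n ^+ 2 / 9 * \sum_y bias y ^+ 2 <=
   n * (16 * (14600 * (m * n * S)) + 20 * (m * T)) + 72 * (n * m * \sum_y (lackO y + 4 * n)).
  rewrite mulr_sumr.
  apply: le_trans (_ : \sum_(y : J) ((16 * (14600 * (m * n * S)) + 20 * (m * T))
      + 72 * (n * m * (lackO y + 4 * n))) <= _).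
    apply: ler_sum => y _; apply: le_trans (discrepancy pk anchor_sign_le1 y) _.
    have : skew y ^+ 2 <= (2 * unmixed_pairs) ^+ 2 by apply: sqr_abs_le; exact: skew_le.
    by move: G; rewrite exprMn; lra.
  by rewrite big_split /= sum_constR lerD2l -!mulr_sumr.
have p0 : 0 < n ^+ 2 by rewrite exprn_gt0.
rewrite -(ler_pM2l p0).
have e1 := ler_wpM2l (ltW (mulr_gt0 n0 m0)) TS.
have e2 := ler_wpM2l (ltW (mulr_gt0 n0 m0)) LS.
have mS := m_le_slack.
have e3 : 0 <= n ^+ 2 * (m * S) by rewrite !mulr_ge0 ?sqr_ge0 // (le_trans _ mS).
move: h e1 e2 e3; set X := \sum_y _; set Y := \sum_y _; lra.
Qed.

(** The counting inequality of row i, solved for the excess of the row. *)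
Lemma row_dev_le i : m * th i <= - deficit - 3 * (\sum_j o i j * ph j) + 10 * m.
Proof.
have := sum_rows_through_le R (packing_transpose pk) i.
rewrite unpaired_transpose.
have -> : total R (transpose O) = total R O by rewrite total_col.
have -> : \sum_j o i j * ph j = \sum_j o i j * col j - 2 * m / 3 * row i.
  by rewrite mulr_sumr -sumrB; apply: eq_bigr => j _; ring.
rewrite /deficit -/(row i).
have -> : \sum_i0 (transpose O i0 i)%:R * row_size R (transpose O) i0 = \sum_j o i j * col j by [].
have -> : col_size R (transpose O) i = row i by [].
have := unp; have := n_le_m; set X := \sum_j _; lra.
Qed.

(** Sum of row_dev_le over the rows off y0.  Column j has (col j - bias j) / 2 such
    rows, so the column excesses contribute their own squares, with a favourable
    sign, and their products with the biases. *)
Lemma sum_off_anchor_dev : \sum_i off_anchor i * th i <= 800 * 1000 * S.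
Proof.
have mS := m_le_slack; have m0 := m_gt0; have n0 := n_gt0.
have B := sum_bias_sqr.
rewrite -(ler_pM2l m0) mulr_sumr.
have h : \sum_i m * (off_anchor i * th i) <= (10 * m - deficit) * \sum_i off_anchor i
    - 3 * \sum_i off_anchor i * (\sum_j o i j * ph j).
  rewrite !mulr_sumr -sumrB; apply: ler_sum => i _.
  have := ler_wpM2l (off_anchor_ge0 i) (row_dev_le i); lra.
apply: le_trans h _.
have -> : \sum_i off_anchor i * (\sum_j o i j * ph j) = \sum_j ph j * ((col j - bias j) / 2).
  under eq_bigr do rewrite mulr_sumr.
  rewrite exchange_big; apply: eq_bigr => j _ /=.
  rewrite /bias /col_size -sumrB mulr_suml mulr_sumr; apply: eq_bigr => i _.
  by rewrite /off_anchor /anchor_sign; field.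
have N0 : 0 <= \sum_i off_anchor i by apply: sumr_ge0 => i _; exact: off_anchor_ge0.
have Nm : \sum_i off_anchor i <= m.
  by rewrite -[m]mulr1 -sum_constR; apply: ler_sum => i _; exact: off_anchor_le1.
have h1 : (10 * m - deficit) * \sum_i off_anchor i <= 16 * m * m.
  apply: le_trans (_ : 16 * m * (\sum_i off_anchor i) <= _).
    rewrite ler_wpM2r //; move: mS; rewrite /slack; lra.
  by rewrite ler_wpM2l // mulr_ge0 // ltW.
have sp : \sum_j ph j = - deficit.
  rewrite sumrB sum_constR -total_col /deficit; lra.
have h2 : - deficit * m / 3 - (\sum_j bias j ^+ 2) / 8 <= \sum_j ph j * ((col j - bias j) / 2).
  rewrite -sp !mulr_suml -sumrB; apply: ler_sum => j _.
  have := sqr_ge0 (ph j - bias j / 2); lra.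
have h3 : deficit <= S by rewrite /slack; lra.
have h4 := ler_wpM2l (ltW m0) mS.
have h5 := ler_wpM2l (ltW m0) h3.
have h6 : 0 <= m * S by rewrite mulr_ge0 // (le_trans _ mS).
move: h1 h2 h4 h5 B; set X := \sum_j _; set Y := \sum_j _; set Z := \sum_i _.
lra.
Qed.

(** Up to the anchored pairs, each pair uses a cell of a row off y0.  There are at
    most n ^ 2 / 2 = (m - (m - n ^ 2)) / 2 such rows, with 2n/3 cells each on
    average. *)
Theorem packing_upper_bound :
  n * (m - n ^+ 2) <= 5000 * 1000 * (m * n / 3 + 3 * m - #|K|%:R).
Proof.
have mS := m_le_slack; have m0 := m_gt0; have n0 := n_gt0.
have ES : anchored_pairs <= 2416 * S by exact: anchored_pairs_le.
have XS := sum_off_anchor_dev.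
have N' := sum_off_anchor_le.
have dp := double_pairs R O r s c d.
have u0 := unpaired_ge0 R pk.
have h : #|K|%:R <= anchored_pairs + \sum_i off_anchor i * row i.
  apply: le_trans (_ : anchored_pairs + \sum_k (off_anchor (r k) + off_anchor (s k)) <= _).
    rewrite -[#|K|%:R]mulr1 -sum_constR -big_split; apply: ler_sum => k _ /=.
    by rewrite /off_anchor; case: (O _ _); case: (O _ _) => /=; lra.
  rewrite lerD2l; apply: le_trans (sum_pair_cells_le pk (g := fun i _ => off_anchor i) _) _.
    by move=> i _; exact: off_anchor_ge0.
  by apply: ler_sum => i _; rewrite -mulr_suml mulrC.
have e : \sum_i off_anchor i * row i = \sum_i off_anchor i * th i + 2 * n / 3 * \sum_i off_anchor i.
  by rewrite mulr_sumr -big_split; apply: eq_bigr => i _ /=; ring.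
have e1 := ler_wpM2l (ltW n0) N'.
have e2 : S = 2 * m * n / 3 - total R O + 6 * m by [].
have un := unp.
move: h e XS e1 e2 dp u0 ES mS un.
set k := #|K|%:R; set X := \sum_i _; set Y := \sum_i _; set Z := \sum_i _.
lra.
Qed.

End Anchor.

(** * Maximum bases *)

Section Base.
Variables m n : nat.
Implicit Types B : {set cell m n}.

Lemma card_base B : #|B| = \sum_r #|row_support B r|.
Proof.
under eq_bigr do rewrite -sum1_card big_mkcond.
rewrite -sum1_card big_mkcond pair_bigA; apply: eq_bigr => -[r c] _ /=.
by rewrite inE.
Qed.

Definition rows_over B (Q : {set 'I_n}) := [set r | Q \subset row_support B r].

Lemma rows_over_le1 B (Q : {set 'I_n}) : c4_free B -> #|Q| = 2 -> #|rows_over B Q| <= 1.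
Proof.
move=> /forallP h Q2; have /eqP/cards2P[c [d [cd ->]]] := Q2.
apply/card_le1P => r; rewrite inE subUset !sub1set !inE => /andP[rc rd] s.
rewrite !inE subUset !sub1set !inE.
apply/andP/eqP => [[sc sd]|->]; last by rewrite rc rd.
apply/eqP; rewrite eq_sym; apply/negPn/negP => rs.
move: (h r) => /forallP/(_ s)/forallP/(_ c)/forallP/(_ d).
by rewrite rs cd rc rd sc sd.
Qed.

Lemma sum_rows_over B :
  \sum_r 'C(#|row_support B r|, 2) = \sum_(Q : {set 'I_n} | #|Q| == 2) #|rows_over B Q|.
Proof.
under eq_bigr do rewrite -cards_draws -sum1_card.
under [RHS]eq_bigr do rewrite -sum1_card.
rewrite [RHS](exchange_big_dep predT) //=; apply: eq_bigr => r _.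
by apply: eq_bigl => Q; rewrite !inE andbC.
Qed.

Lemma sum_column_pairs : \sum_(Q : {set 'I_n} | #|Q| == 2) 1 = 'C(n, 2).
Proof.
rewrite -[X in 'C(X, 2)]card_ord -card_draws -sum1_card.
by apply: eq_bigl => Q; rewrite inE.
Qed.

(** Equality only for k = 1 and k = 2, which is what pins down maximum bases. *)
Lemma leq_bin2 k : k <= 1 + 'C(k, 2).
Proof. by elim: k => // k IH; rewrite binS bin1 addnA -addn1; case: k IH => // k; lia. Qed.

Lemma leq_bin2_eq k : k = 1 + 'C(k, 2) -> k = 1 \/ k = 2.
Proof.
case: k => [|[|[|k]]]; rewrite ?bin0n //; [by left|by right|].
by rewrite binS bin1; have := leq_bin2 k.+2; rewrite binS bin1; have := leq_bin2 k.+1; lia.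
Qed.

Lemma card_c4_free B : c4_free B -> #|B| <= m + 'C(n, 2).
Proof.
move=> h; rewrite card_base.
apply: leq_trans (_ : \sum_r (1 + 'C(#|row_support B r|, 2)) <= _).
  by apply: leq_sum => r _; exact: leq_bin2.
rewrite big_split sum1_card card_ord leq_add2l sum_rows_over -sum_column_pairs.
by apply: leq_sum => Q /eqP; exact: rows_over_le1.
Qed.

Lemma eq_sum_leq (T : finType) (P : pred T) (f g : T -> nat) :
  (forall x, P x -> f x <= g x) -> \sum_(x | P x) g x <= \sum_(x | P x) f x ->
  forall x, P x -> f x = g x.
Proof.
move=> fg gf x Px; apply/eqP; rewrite eqn_leq fg //=.
rewrite (bigD1 x) //= [leqRHS](bigD1 x) //= in gf.
have : \sum_(i | P i && (i != x)) f i <= \sum_(i | P i && (i != x)) g i.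
  by apply: leq_sum => i /andP[/fg].
lia.
Qed.

(** The bound |B| <= m + 'C(n, 2) comes from two termwise inequalities, d <= 1 +
    'C(d, 2) for the size d of a row and at most one row over each column pair;
    equality in the sum forces equality in each term. *)
Lemma extremal_base B : c4_free B -> #|B| = m + 'C(n, 2) ->
  (forall r, #|row_support B r| = 1 \/ #|row_support B r| = 2) /\
  (forall Q : {set 'I_n}, #|Q| = 2 -> #|rows_over B Q| = 1).
Proof.
move=> h e.
have le1 : \sum_r #|row_support B r| <= \sum_r (1 + 'C(#|row_support B r|, 2)).
  by apply: leq_sum => r _; exact: leq_bin2.
have s1 : \sum_r (1 + 'C(#|row_support B r|, 2)) =
    m + \sum_(Q : {set 'I_n} | #|Q| == 2) #|rows_over B Q|.
  by rewrite big_split sum1_card card_ord sum_rows_over.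
rewrite card_base in e.
split=> [r|Q Q2].
  apply: leq_bin2_eq.
  apply: (eq_sum_leq (P := predT) (f := fun r => #|row_support B r|)
     (g := fun r => 1 + 'C(#|row_support B r|, 2))) => // [x _|].
    exact: leq_bin2.
  rewrite s1 e leq_add2l -sum_column_pairs; apply: leq_sum => Q /eqP.
  exact: rows_over_le1.
apply: (eq_sum_leq (P := fun Q : {set 'I_n} => #|Q| == 2)
     (f := fun Q => #|rows_over B Q|) (g := fun _ => 1)) => [Q' /eqP||]; last by rewrite Q2.
  exact: rows_over_le1.
by rewrite sum_column_pairs -(leq_add2l m) -s1 -e.
Qed.

Lemma card_first_column : 0 < n -> #|first_column n| = 1.
Proof.
case: n => // k _; apply/eqP/cards1P; exists ord0; apply/setP => c.
by rewrite !inE -val_eqE.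
Qed.

Lemma card_double_rows B :
  (forall Q : {set 'I_n}, #|Q| = 2 -> #|[set r | row_support B r == Q]| = 1) ->
  #|[set r | #|row_support B r| == 2]| = 'C(n, 2).
Proof.
move=> h1; rewrite -[X in 'C(X, 2)]card_ord -card_draws -!sum1_card.
rewrite (partition_big (row_support B) (mem [set Q : {set 'I_n} | #|Q| == 2])) /=; last first.
  by move=> i; rewrite !inE.
apply: eq_bigr => Q; rewrite inE => /eqP Q2; rewrite sum1dep_card -[RHS](h1 _ Q2).
apply: eq_card => i; rewrite !inE; case: (row_support B i =P Q) => [->|]; last by rewrite andbF.
by rewrite Q2.
Qed.

Lemma canonical_rows B : 0 < n -> 'C(n, 2) <= m -> canonical_base B ->
  forall r, row_support B r = first_column n \/ #|row_support B r| = 2.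
Proof.
move=> n0 Cm [h1 h2] r.
have fc1 := card_first_column n0.
pose X := [set r | row_support B r == first_column n].
pose Y := [set r | #|row_support B r| == 2].
have cY : #|Y| = 'C(n, 2) by exact: card_double_rows.
have dXY : [disjoint X & Y].
  rewrite -setI_eq0; apply/eqP/setP => i; rewrite !inE; apply/negP => /andP[/eqP -> /eqP].
  by rewrite fc1.
have cU : #|X :|: Y| = m.
  by rewrite cardsU (eqP (_ : X :&: Y == set0)) ?setI_eq0 // cards0 cY h2; lia.
have : r \in X :|: Y.
  have : X :|: Y == setT by rewrite eqEcard subsetT cU cardsT card_ord /=.
  by move=> /eqP ->; rewrite inE.
by rewrite !inE => /orP[/eqP|/eqP]; [left|right].
Qed.

Lemma canonical_card B : 0 < n -> 'C(n, 2) <= m -> canonical_base B ->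
  #|B| = m + 'C(n, 2).
Proof.
move=> n0 Cm cB; have h := canonical_rows n0 Cm cB; have [h1 h2] := cB.
rewrite card_base.
have -> : \sum_r #|row_support B r| = \sum_r (1 + (#|row_support B r| == 2)).
  by apply: eq_bigr => r _; case: (h r) => ->; rewrite ?card_first_column.
rewrite big_split sum1_card card_ord; congr (_ + _).
by rewrite -(card_double_rows h1) -sum1_card [RHS]big_mkcond; apply: eq_bigr => r _; rewrite inE.
Qed.

Lemma canonical_inj B r s : canonical_base B -> #|row_support B r| = 2 ->
  row_support B r = row_support B s -> r = s.
Proof.
move=> [h1 _] r2 rs; have /eqP/cards1P[x e] := h1 _ r2.
have : r \in [set x] by rewrite -e inE.
have : s \in [set x] by rewrite -e inE rs.
by rewrite !inE => /eqP -> /eqP ->.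
Qed.

Lemma canonical_c4 B : 0 < n -> 'C(n, 2) <= m -> canonical_base B -> c4_free B.
Proof.
move=> n0 Cm cB; have h := canonical_rows n0 Cm cB.
apply/forallP => r; apply/forallP => s; apply/forallP => c; apply/forallP => d.
apply/implyP => rs; apply/implyP => cd; apply/negP => /and4P[rc rd sc sd].
have aux t : (t, c) \in B -> (t, d) \in B -> row_support B t = [set c; d].
  move=> tc td; apply/esym/eqP; rewrite eqEcard cards2 cd; apply/andP; split.
    by rewrite subUset !sub1set !inE tc td.
  by case: (h t) => ->; rewrite ?card_first_column.
have ers : r = s.
  by apply: (canonical_inj cB); rewrite (aux r) // ?(aux s) // cards2 cd.
by rewrite ers eqxx in rs.
Qed.

Lemma zarankiewicz_eq : 0 < n -> 'C(n, 2) <= m -> zarankiewicz m n = m + 'C(n, 2).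
Proof.
move=> n0 Cm; apply/eqP; rewrite eqn_leq; apply/andP; split.
  by apply/bigmax_leqP => B; exact: card_c4_free.
have [B cB] := canonical_base_exists Cm.
rewrite -(canonical_card n0 Cm cB).
exact: (leq_bigmax_cond (F := fun B : {set cell m n} => #|B|) B (canonical_c4 n0 Cm cB)).
Qed.

Lemma canonical_maximum B : 0 < n -> 'C(n, 2) <= m -> canonical_base B -> maximum_base B.
Proof.
move=> n0 Cm cB; rewrite /maximum_base canonical_c4 //=.
by rewrite canonical_card // zarankiewicz_eq.
Qed.

End Base.

(** * Augmentations of the canonical base *)

Section Augmentation.
Variables m n : nat.
Variables (B : {set cell m n}) (E : {set {set cell m n}}).
Hypothesis adm : admissible B E.

Local Notation K := {P : {set cell m n} | P \in E}.

Lemma selected_cells :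
  exists f g : K -> cell m n, forall k, f k != g k /\ val k = [set f k; g k].
Proof.
have h (k : K) : exists x : cell m n * cell m n, x.1 != x.2 /\ val k = [set x.1; x.2].
  have [/forallP/(_ (val k)) h _ _ _] := and4P adm.
  have /andP[/cards2P[x [y [xy e]]] _] := implyP h (valP k).
  by exists (x, y).
have [f hf] := fin_all_exists h.
by exists (fun k => (f k).1), (fun k => (f k).2) => k; exact: hf.
Qed.

Variables f g : K -> cell m n.
Hypothesis fg : forall k, f k != g k /\ val k = [set f k; g k].

Lemma usage_sum i j :
  usage (fun k => (f k).1) (fun k => (g k).1) (fun k => (f k).2) (fun k => (g k).2) i j
  = \sum_(k : K) ((i, j) \in val k).
Proof.
rewrite /usage -big_split; apply: eq_bigr => k _ /=.
have [ne ->] := fg k; rewrite !inE.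
have aux (x : cell m n) : (x.1 == i) && (x.2 == j) = ((i, j) == x).
  by rewrite eq_sym [x.2 == j]eq_sym; case: x.
by rewrite !aux; case: ((i, j) =P f k) => [->|_] //=; rewrite (negPf ne).
Qed.

Lemma admissible_packing :
  packing (fun i j => (i, j) \in occupied B E)
    (fun k => (f k).1) (fun k => (g k).1) (fun k => (f k).2) (fun k => (g k).2).
Proof.
have [_ tr _ c3] := and4P adm; split=> [i j|k x y xr xs yc yd].
  rewrite usage_sum.
  have [k0 ik0|no] := pickP (fun k : K => (i, j) \in val k); last first.
    by rewrite big1 // => k _; rewrite no.
  rewrite (bigD1 k0) //= ik0 big1 => [|k kk0].
    have -> // : (i, j) \in occupied B E.
    rewrite inE; apply/orP; right; apply/bigcupP; exists (val k0) => //; exact: valP.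
  case ik: ((i, j) \in val k) => //.
  case/negP: kk0; apply/eqP/val_inj; apply/eqP/negPn/negP => ne.
  have := trivIsetP tr _ _ (valP k) (valP k0) ne; rewrite -setI_eq0 => /eqP/setP/(_ (i, j)).
  by rewrite !inE ik ik0.
have [ne e] := fg k.
move: c3 => /forallP/(_ (f k).1)/forallP/(_ (f k).2)/forallP/(_ (g k).1)/forallP/(_ (g k).2).
rewrite -!surjective_pairing -e (valP k) /= => /forallP/(_ x)/forallP/(_ y).
by rewrite !inE (negPf xr) (negPf xs) (negPf yc) (negPf yd) /=.
Qed.

Lemma unpaired_le (R : realFieldType) :
  (unpaired R (fun i j => (i, j) \in occupied B E)
    (fun k => (f k).1) (fun k => (g k).1) (fun k => (f k).2) (fun k => (g k).2)
    <= #|B|%:R)%R.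
Proof.
rewrite card_base natr_sum; apply: ler_sum => i _.
rewrite -sum_mem; apply: ler_sum => j _; rewrite !inE usage_sum lerBlDr -natrD ler_nat.
case: ((i, j) \in B) => /=; first exact: leq_addr.
case ic: ((i, j) \in cover E) => //=.
have /bigcupP[P PE iP] := ic.
by rewrite add0n (bigD1 (exist _ P PE)) //= iP.
Qed.

End Augmentation.

Section UpperBound.
Local Open Scope ring_scope.
Variables (R : realFieldType) (m n : nat).

(** The anchor is the first column.  A row that misses it is not a single row, and
    the rows with two base cells have distinct supports. *)
Lemma admissible_upper_bound (B : {set cell m n}) (E : {set {set cell m n}}) :
  (2 <= n)%N -> (n ^ 2 <= m)%N -> canonical_base B -> admissible B E ->
  n%:R * (m%:R - n%:R ^+ 2) <= 5000 * 1000 * (m%:R * n%:R / 3 + 3 * m%:R - #|E|%:R) :> R.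
Proof.
move=> n2 nm cB adm.
have Cm : ('C(n, 2) <= m)%N.
  by apply: leq_trans nm; have := double_bin2_le n; lia.
have n0 : (0 < n)%N by exact: ltnW.
have [f [g fg]] := selected_cells adm.
have pk := admissible_packing adm fg.
have -> : #|E| = #|{: {P | P \in E}}| by rewrite card_sig; apply: eq_card.
have := @packing_upper_bound R _ _ _ _ _ _ _ _ pk (Ordinal n0).
rewrite !card_ord; apply => //.
  apply: le_trans (unpaired_le B fg R) _.
  by rewrite (canonical_card n0 Cm cB) -natrM ler_nat; lia.
move=> W; rewrite -cards_draws.
have h := canonical_rows n0 Cm cB.
have rs2 i : i \in [set i | (i, Ordinal n0) \notin occupied B E &
    [forall j, ((i, j) \in occupied B E) ==> (j \in W)]] -> #|row_support B i| = 2.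
  rewrite inE => /andP[nO _]; case: (h i) => // e.
  have : Ordinal n0 \in row_support B i by rewrite e inE.
  by rewrite inE => iB; rewrite inE iB in nO.
rewrite -(card_in_imset (f := row_support B)); last first.
  by move=> i i' /rs2 i2 _ /(canonical_inj cB i2).
apply: subset_leq_card; apply/subsetP => Q /imsetP[i iX ->].
rewrite inE (rs2 _ iX) eqxx andbT; apply/subsetP => j; rewrite inE => ij.
move: iX; rewrite inE => /andP[_ /forallP/(_ j)]; by rewrite inE ij.
Qed.

Lemma admissible0 (B : {set cell m n}) : admissible B set0.
Proof.
apply/and4P; split.
- by apply/forallP => P; rewrite inE.
- by apply/trivIsetP => P Q; rewrite inE.
- do 4 (apply/forallP => ?); by rewrite inE.
- do 4 (apply/forallP => ?); by rewrite inE.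
Qed.

Lemma canonical_upper_bound (B : {set cell m n}) :
  (2 <= n)%N -> (n ^ 2 <= m)%N -> canonical_base B ->
  n%:R * (m%:R - n%:R ^+ 2) <= 5000 * 1000 * (m%:R * n%:R / 3 + 3 * m%:R - (Tstar B)%:R) :> R.
Proof.
move=> n2 nm cB; rewrite /Tstar.
have [|E adm ->] := eq_bigmax_cond (A := [pred E | admissible B E]) (fun E => #|E|).
  by apply/card_gt0P; exists set0; rewrite inE admissible0.
by rewrite inE in adm; apply: (admissible_upper_bound n2 nm cB adm).
Qed.

End UpperBound.

(** * Admissible families from three types of rows *)

Section Layout.
Variables (m n k t : nat) (B : {set cell m n}).
Variables (col : 'I_3 -> 'I_k -> 'I_n) (row : 'I_3 -> 'I_t -> 'I_m).

(** Here row u j is the j-th row of type u and col p i the i-th column of part p.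
    The last clause concerns two rows that will be joined, with indices j and
    rev_ord j: they share no base cell in a column outside the parts. *)
Record layout : Prop := Layout {
  layout_col : forall p i p' i', col p i = col p' i' -> p = p' /\ i = i';
  layout_row : forall u j u' j', row u j = row u' j' -> u = u' /\ j = j';
  layout_small : forall r, #|row_support B r| <= 2;
  layout_avoid : forall u j i, (row u j, col u i) \notin B;
  layout_clean : forall u v j y, (row u j, y) \in B -> (row v (rev_ord j), y) \in B ->
    exists p i, y = col p i }.

Hypothesis L : layout.

Definition layout_cell u v j i : cell m n := (row u j, col v i).

(** Over the three values of u, the sets {u, ordS u} run once through the
    two-element sets of types.  Reversing j is an involution, as needed for the
    two rows of a pair to play the same part. *)
Definition layout_pair (x : 'I_3 * 'I_t * 'I_k) : {set cell m n} :=
  let: (u, j, i) := x in [set layout_cell u (ordS u) j i; layout_cell (ordS u) u (rev_ord j) i].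

(** Only the pairs that miss the base are selectable. *)
Definition layout_family : {set {set cell m n}} :=
  [set layout_pair x | x in [pred x | [disjoint layout_pair x & B]]].

Lemma layout_cell_inj u v j i u' v' j' i' : layout_cell u v j i = layout_cell u' v' j' i' ->
  [/\ u = u', v = v', j = j' & i = i'].
Proof. by case=> /(layout_row L)[-> ->] /(layout_col L)[-> ->]. Qed.

Lemma ordS_neq (u : 'I_3) : ordS u != u.
Proof. by case: u => [[|[|[|]]]]. Qed.

Lemma ordSS_neq (u : 'I_3) : ordS (ordS u) != u.
Proof. by case: u => [[|[|[|]]]]. Qed.

Lemma third_type (u v p w : 'I_3) : u != v -> p != u -> p != v -> w != u -> w != v -> w = p.
Proof.
case: u => [[|[|[|]]] // ?]; case: v => [[|[|[|]]] // ?]; case: p => [[|[|[|]]] // ?];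
case: w => [[|[|[|]]] // ?] *; exact: val_inj.
Qed.

Lemma mem_layout_pair x y b : b \in layout_pair x -> b \in layout_pair y -> x = y.
Proof.
case: x => -[u j] i; case: y => -[v j'] i'; rewrite !inE.
case/orP => /eqP ->; case/orP => /eqP /layout_cell_inj[e1 e2 e3 e4].
- by rewrite e1 e3 e4.
- by have := ordSS_neq v; rewrite -e1 e2 eqxx.
- by have := ordSS_neq u; rewrite e1 -e2 eqxx.
- by rewrite e2 e4 (rev_ord_inj e3).
Qed.

Lemma layout_pair_cells x r c s d : [set (r, c); (s, d)] = layout_pair x ->
  exists u v j i,
    [/\ u != v, (r, c) = layout_cell u v j i & (s, d) = layout_cell v u (rev_ord j) i].
Proof.
case: x => -[u j] i e.
have uS := ordS_neq u.
have ne : layout_cell u (ordS u) j i != layout_cell (ordS u) u (rev_ord j) i.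
  by apply: contraNneq uS => /layout_cell_inj[<-].
have h1 : (r, c) \in layout_pair (u, j, i) by rewrite -e !inE eqxx.
have h2 : (s, d) \in layout_pair (u, j, i) by rewrite -e !inE eqxx orbT.
have h3 : layout_cell u (ordS u) j i \in [set (r, c); (s, d)] by rewrite e !inE eqxx.
have h4 : layout_cell (ordS u) u (rev_ord j) i \in [set (r, c); (s, d)] by rewrite e !inE eqxx orbT.
move: h1 h2; rewrite !inE => /orP[/eqP e1|/eqP e1].
  case/orP => /eqP e2; last by exists u, (ordS u), j, i; rewrite eq_sym uS.
  by move: h4; rewrite !inE e1 e2 orbb eq_sym (negPf ne).
case/orP => /eqP e2; last by move: h3; rewrite !inE e1 e2 orbb (negPf ne).
by exists (ordS u), u, (rev_ord j), i; rewrite rev_ordK.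
Qed.

Lemma mem_cover r c : (r, c) \in cover layout_family ->
  exists u v j i, [/\ u != v, r = row u j & c = col v i].
Proof.
case/bigcupP => P /imsetP[[[u j] i] _ ->]; rewrite !inE => /orP[] /eqP[-> ->].
  by exists u, (ordS u), j, i; rewrite eq_sym ordS_neq.
by exists (ordS u), u, (rev_ord j), i; rewrite ordS_neq.
Qed.

Lemma occupied_avoid u j i : (row u j, col u i) \notin occupied B layout_family.
Proof.
rewrite inE negb_or (layout_avoid L) /=; apply/negP => /mem_cover[u' [v' [j' [i' [ne]]]]].
by move=> /(layout_row L)[e _] /(layout_col L)[e' _]; rewrite -e -e' eqxx in ne.
Qed.

Lemma occupied_offcol r y : (forall p i, y <> col p i) ->
  (r, y) \in occupied B layout_family -> (r, y) \in B.
Proof.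
move=> h; rewrite inE => /orP[//|/mem_cover[u [v [j [i [_ _ e]]]]]].
by case: (h v i).
Qed.

Lemma occupied_offrow x y : (forall u j, x <> row u j) ->
  (x, y) \in occupied B layout_family -> y \in row_support B x.
Proof.
move=> h; rewrite !inE => /orP[//|/mem_cover[u [v [j [i [_ e _]]]]]].
by case: (h u j).
Qed.

(** C2: the opposite cells lie in the omitted parts.  C3: the column y lies in the
    third part or in no part.  In the first case a row x meeting both columns of
    the pair and y meets all three parts; typed rows do not, and an untyped row has
    at most two cells.  The second case is excluded by layout_clean. *)
Lemma layout_family_admissible : admissible B layout_family.
Proof.
apply/and4P; split.
- apply/forallP => P; apply/implyP => /imsetP[x dx ->].
  apply/andP; split=> //; case: x dx => -[u j] i _; rewrite cards2.
  case: (layout_cell u (ordS u) j i =P _) => // /layout_cell_inj[e _ _ _].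
  by have := ordS_neq u; rewrite -e eqxx.
- apply/trivIsetP => P Q /imsetP[x _ ->] /imsetP[y _ ->] ne.
  rewrite -setI_eq0; apply/eqP/setP => b; rewrite in_set0 in_setI; apply/negP => /andP[bx by_].
  by rewrite (mem_layout_pair bx by_) eqxx in ne.
- apply/forallP => r; apply/forallP => c; apply/forallP => s; apply/forallP => d.
  apply/implyP => /imsetP[x _ /layout_pair_cells[u [v [j [i [uv [-> ->] [-> ->]]]]]]].
  apply/implyP => _; apply/implyP => _.
  by rewrite (negPf (occupied_avoid _ _ _)).
apply/forallP => r; apply/forallP => c; apply/forallP => s; apply/forallP => d.
apply/implyP => /imsetP[x0 _ /layout_pair_cells[u [v [j [i [uv [-> ->] [-> ->]]]]]]].
apply/forallP => x; apply/forallP => y; apply/implyP => _; apply/implyP.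
rewrite !in_set2 negb_or => /andP[yc yd]; apply/negP => /and5P[xy xc xd ry sy].
have [/existsP[p /existsP[l /eqP ey]]|noy] := boolP [exists p, exists l, y == col p l].
  have pu : p != u by apply: contraTneq ry => pu; rewrite ey pu occupied_avoid.
  have pv : p != v by apply: contraTneq sy => pv; rewrite ey pv occupied_avoid.
  have [/existsP[w /existsP[l' /eqP ex]]|nox] := boolP [exists w, exists l', x == row w l'].
    have wu : w != u by apply: contraTneq xd => wu; rewrite ex wu occupied_avoid.
    have wv : w != v by apply: contraTneq xc => wv; rewrite ex wv occupied_avoid.
    have wp := third_type uv pu pv wu wv.
    by move: xy; rewrite ex ey wp (negPf (occupied_avoid _ _ _)).
  have off : forall u j, x <> row u j.
    by move=> w l' ex; case/negP: nox; apply/existsP; exists w; apply/existsP; exists l'; apply/eqP.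
  have : [set col v i; col u i; y] \subset row_support B x.
    by rewrite !subUset !sub1set !(occupied_offrow off).
  move/subset_leq_card => le3; have := leq_trans le3 (layout_small L x).
  rewrite -setUA cardsU1 cards2 !inE (negbTE (_ : col v i != col u i)) /=; last first.
    by apply: contraNneq uv => /(layout_col L)[->].
  by rewrite eq_sym (negPf yc) eq_sym (negPf yd).
have off : forall p i, y <> col p i.
  by move=> p l ey; case/negP: noy; apply/existsP; exists p; apply/existsP; exists l; apply/eqP.
(* The column y is in no part, so both cells in it are base cells. *)
have [p [l ey]] := layout_clean L (occupied_offcol off ry) (occupied_offcol off sy).
exact: (off p l ey).
Qed.

(** Each base cell spoils at most one pair. *)
Lemma layout_family_card : 3 * t * k <= #|layout_family| + #|B|.
Proof.
rewrite /layout_family card_in_imset; last first.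
  move=> [[u j] i] y _ _ e; apply: (@mem_layout_pair _ _ (layout_cell u (ordS u) j i)).
    by rewrite !inE eqxx.
  by rewrite -e !inE eqxx.
have -> : 3 * t * k = #|{: 'I_3 * 'I_t * 'I_k}| by rewrite !card_prod !card_ord.
rewrite -(cardC [pred x | [disjoint layout_pair x & B]]) leq_add2l.
apply: leq_trans (_ : \sum_(b in B) \sum_x (b \in layout_pair x) <= _); last first.
  rewrite -sum1_card; apply: leq_sum => b _.
  have [x bx|no] := pickP (fun x => b \in layout_pair x); last first.
    by rewrite big1 // => x _; rewrite no.
  rewrite (bigD1 x) //= bx big1 // => y yx; case by_: (b \in layout_pair y) => //.
  by rewrite (mem_layout_pair bx by_) eqxx in yx.
rewrite exchange_big /= -sum1_card big_mkcond /=; apply: leq_sum => x _.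
rewrite !inE; have [//|/pred0Pn[b /andP[/= bx bB]]] := boolP [disjoint layout_pair x & B].
by rewrite (bigD1 b) //= bx.
Qed.

End Layout.

(** * Choosing the parts and the types *)

Lemma subset_of_size (T : finType) (X : {set T}) q : q <= #|X| ->
  exists2 A : {set T}, A \subset X & #|A| = q.
Proof.
rewrite -bin_gt0 -cards_draws => /card_gt0P[A]; rewrite inE => /andP[AX /eqP Aq].
by exists A.
Qed.

Lemma subset_of_size_near (T : finType) (C X : {set T}) q : C \subset X -> q <= #|X| ->
  exists A : {set T}, [/\ A \subset X, #|A| = q & (A \subset C) || (C \subset A)].
Proof.
move=> CX qX; have [qC|Cq] := leqP q #|C|.
  have [A hAC Aq] := subset_of_size qC; exists A; split=> //; last by rewrite hAC.
  exact: subset_trans hAC CX.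
have [|A AXC Aq] := @subset_of_size _ (X :\: C) (q - #|C|).
  by rewrite cardsD (setIidPr CX) leq_sub2r.
have /subsetDP[AX dA] : A \subset X :\: C by [].
exists (C :|: A); split; last by rewrite subsetUl orbT.
  by rewrite subUset CX.
by rewrite cardsU Aq disjoint_setI0 ?cards0 1?disjoint_sym //; lia.
Qed.

(** Three disjoint sets of size q are wanted, the u-th avoiding P_u.  The set that
    avoids P1 is chosen first and takes as much of P0, the largest obstacle, as
    possible; the set that avoids P0 then takes as much of P2 as possible, and
    enough is left outside P2 for the last one. *)
Lemma three_way_split (T : finType) (Y P0 P1 P2 : {set T}) q :
  P0 \subset Y -> P1 \subset Y -> P2 \subset Y ->
  [disjoint P0 & P1] -> [disjoint P0 & P2] -> [disjoint P1 & P2] ->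
  #|P1| <= #|P0| -> #|P2| <= #|P1| -> 2 * #|P0| <= #|Y| -> 3 * q <= #|Y| ->
  exists A : 'I_3 -> {set T}, forall u, [/\ #|A u| = q, A u \subset Y,
     [disjoint A u & nth set0 [:: P0; P1; P2] u] &
     forall v, u != v -> [disjoint A u & A v]].
Proof.
move=> P0Y P1Y P2Y d01 d02 d12 le10 le21 le0Y qY.
have P012 : #|P0| + #|P1| + #|P2| <= #|Y|.
  have <- : #|P0 :|: P1 :|: P2| = #|P0| + #|P1| + #|P2|.
    rewrite !cardsU disjoint_setI0 // cards0 subn0 disjoint_setI0 ?cards0 ?subn0 //.
    by rewrite disjoints_subset subUset -!disjoints_subset d02.
  by rewrite subset_leq_card // !subUset P0Y P1Y.
have cD (X P : {set T}) : #|X| <= #|X :\: P| + #|P|.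
  by have := cardsID P X; have := subset_leq_card (subsetIr X P); lia.
have [||A1 [A1Y A1q hA1]] := @subset_of_size_near _ P0 (Y :\: P1) q.
  by rewrite subsetD P0Y.
  have := cD Y P1; lia.
have [A1Y' A1P1] := subsetDP A1Y.
pose Z := Y :\: A1.
have cZ : #|Z| = #|Y| - q by rewrite cardsD (setIidPr A1Y') A1q.
have Z0 : q <= #|Z :\: P0|.
  case/orP: hA1 => h.
    apply: leq_trans (_ : #|Y :\: P0| <= _); first by move: (cD Y P0) le0Y qY; clear; lia.
    by rewrite subset_leq_card // /Z setDDl setDS // subUset h /=.
  have -> : Z :\: P0 = Z by rewrite /Z setDDl (setUidPl h).
  by rewrite cZ; move: qY; clear; lia.
have Z2 : q <= #|Z :\: P2|.
  case/orP: hA1 => h; first by move: (cD Z P2) cZ P012 le10 le21 qY; clear; lia.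
  by move: (cD Z P2) (subset_leq_card h) cZ A1q le10 le21 qY; clear; lia.
have [|A0 [A0Z A0q hA0]] := @subset_of_size_near _ (P2 :&: Z) (Z :\: P0) q _ Z0.
  rewrite subsetD subsetIr /= disjoint_sym; apply: disjointWr d02; exact: subsetIl.
have [A0Z' A0P0] := subsetDP A0Z.
have [|A2 A2Z A2q] := @subset_of_size _ ((Z :\: A0) :\: P2) q.
  case/orP: hA0 => h.
    have -> : (Z :\: A0) :\: P2 = Z :\: P2.
      by rewrite setDDl (setUidPr _) // (subset_trans h) ?subsetIl.
    exact: Z2.
  have -> : (Z :\: A0) :\: P2 = Z :\: A0.
    apply/setP => x; rewrite !inE; have := subsetP h x; rewrite !inE.
    by case: (x \in P2); case: (x \in Y); case: (x \in A1); case: (x \in A0) => //= ->.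
  by move: (cD Z A0); rewrite cZ A0q; move: qY; clear; lia.
have [A2ZA A2P2] := subsetDP A2Z.
have [A2Z' A2A0] := subsetDP A2ZA.
have [A0Y A0A1] := subsetDP A0Z'.
have [A2Y A2A1] := subsetDP A2Z'.
exists (fun u => nth set0 [:: A0; A1; A2] u) => u; split.
- by case: u => [[|[|[|]]]].
- by case: u => [[|[|[|]]]].
- by case: u => [[|[|[|]]]].
by case: u => [[|[|[|]]] // ?] [[|[|[|]]] // ?]; rewrite -val_eqE //= => _; rewrite // disjoint_sym.
Qed.

Lemma sum_triples (a : nat -> nat) k :
  a 0 + \sum_(i < k) a (3 * i + 1) + \sum_(i < k) a (3 * i + 2) + \sum_(i < k) a (3 * i + 3)
  = \sum_(i < 3 * k + 1) a i.
Proof.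
elim: k => [|k IH]; first by rewrite muln0 add0n !big_ord0 big_ord1 !addn0.
have -> : 3 * k.+1 + 1 = (3 * k + 1).+3 by lia.
set n := 3 * k + 1 in IH *; rewrite !big_ord_recr /= -IH.
have -> : 3 * k + 2 = n.+1 by rewrite /n; lia.
have -> : 3 * k + 3 = n.+2 by rewrite /n; lia.
rewrite -/n; set X := \sum_(i < k) _; set Y := \sum_(i < k) _; set Z := \sum_(i < k) _; lia.
Qed.

(** Sort the columns by decreasing weight, set the first one aside and deal the
    others out in turn to the three parts.  The heaviest part weighs no more than
    the lightest one together with the column set aside, hence at most half of
    the total. *)
Lemma deal_columns n k (w : 'I_n -> nat) : 3 * k + 1 <= n ->
  exists col : 'I_3 -> 'I_k -> 'I_n,
  (forall p i p' i', col p i = col p' i' -> p = p' /\ i = i') /\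
  [/\ \sum_i w (col (inord 1) i) <= \sum_i w (col (inord 0) i),
      \sum_i w (col (inord 2) i) <= \sum_i w (col (inord 1) i)
    & 2 * \sum_i w (col (inord 0) i) <= \sum_c w c].
Proof.
move=> kn.
have n0 : 0 < n by lia.
pose x0 := Ordinal n0.
pose e := sort (fun x y => w y <= w x) (enum 'I_n).
have se : size e = n by rewrite size_sort size_enum_ord.
have ue : uniq e by rewrite sort_uniq enum_uniq.
pose a i := w (nth x0 e i).
have a_mono i j : i <= j -> j < n -> a j <= a i.
  move=> ij jn; apply: (@sorted_leq_nth _ (fun x y => w y <= w x)) => //.
  - by move=> x y z h1 h2; exact: leq_trans h2 h1.
  - by apply: sort_sorted => x y; exact: leq_total.
  - by rewrite inE se (leq_ltn_trans ij).
  - by rewrite inE se.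
have sum_a : \sum_(i < n) a i = \sum_c w c.
  rewrite -(big_mkord predT a) -{1}se -(big_nth x0 predT w) /e.
  by rewrite (perm_big (enum 'I_n)) ?perm_sort // big_enum.
exists (fun p i => nth x0 e (3 * i + 1 + p)); split.
  move=> p i p' i' /eqP; rewrite nth_uniq ?se //;
    try by have := ltn_ord p; have := ltn_ord p'; have := ltn_ord i; have := ltn_ord i'; lia.
  have := ltn_ord p; have := ltn_ord p' => h1 h2 /eqP h.
  by split; apply: val_inj => /=; lia.
rewrite !inordK //.
have i_lt (i : 'I_k) : 3 * i + 3 < n by have := ltn_ord i; lia.
split.
- by apply: leq_sum => i _; apply: a_mono; have := i_lt i; lia.
- by apply: leq_sum => i _; apply: a_mono; have := i_lt i; lia.
rewrite -sum_a.
apply: leq_trans (_ : \sum_(i < 3 * k + 1) a i <= _); last first.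
  rewrite -(big_mkord predT a) -(big_mkord predT a) [leqRHS](@big_cat_nat _ _ _ (3 * k + 1)) //=.
  exact: leq_addr.
rewrite -sum_triples.
have h1 : \sum_(i < k) a (3 * i + 1 + 0) <= a 0 + \sum_(i < k) a (3 * i + 3).
  apply: leq_trans (_ : \sum_(i < k.+1) a (3 * i) <= _).
    (* Position 3i + 1 of the sorted list is not heavier than position 3i, and the
       positions 3i form the last part, shifted by one, with position 0 added. *)
    rewrite big_ord_recr /=; apply: leq_trans (leq_addr _ _).
    by apply: leq_sum => i _; apply: a_mono; have := i_lt i; lia.
  rewrite big_ord_recl /= muln0 leq_add2l; apply: leq_sum => i _.
  by rewrite /bump /= mulnDr muln1 addnC.
have h2 : \sum_(i < k) a (3 * i + 1 + 0) = \sum_(i < k) a (3 * i + 1).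
  by apply: eq_bigr => i _; rewrite addn0.
move: h1; rewrite h2.
set X := \sum_(i < k) _; set Y := \sum_(i < k) _; set Z := \sum_(i < k) _; lia.
Qed.

Section Build.
Variables (m n k q : nat) (B : {set cell m n}).
Hypothesis rows12 : forall r, #|row_support B r| = 1 \/ #|row_support B r| = 2.
Hypothesis over1 : forall Q : {set 'I_n}, #|Q| = 2 -> #|rows_over B Q| = 1.
Local Notation rs := (row_support B).

Lemma card_rows_eq (Q : {set 'I_n}) : #|Q| = 2 -> #|[set r | rs r == Q]| = 1.
Proof.
move=> Q2; rewrite -[RHS](over1 Q2); apply: eq_card => r; rewrite !inE.
by rewrite eq_sym eqEcard Q2; case: (rows12 r) => ->; rewrite andbT.
Qed.

Definition single_rows := [set r | #|rs r| == 1].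

Lemma card_single_rows : #|single_rows| = m - 'C(n, 2).
Proof.
have e := cardsC [set r | #|rs r| == 2]; rewrite card_ord (card_double_rows card_rows_eq) in e.
have -> : single_rows = ~: [set r | #|rs r| == 2].
  by apply/setP => r; rewrite !inE; case: (rows12 r) => ->.
by apply/eqP; rewrite -(eqn_add2l 'C(n, 2)) e subnKC // -e leq_addr.
Qed.

(** Relates the weights of the columns, which are dealt out evenly, to the rows that
    cannot be given the type of a part. *)
Lemma sum_single_rows (A : {set 'I_n}) :
  \sum_(c in A) #|[set r | rs r == [set c]]| = #|[set r in single_rows | rs r \subset A]|.
Proof.
under eq_bigr do rewrite -sum1_card big_mkcond.
rewrite exchange_big -sum1_card [RHS]big_mkcond; apply: eq_bigr => r _ /=.
rewrite !inE; case: ifP => [/andP[/cards1P[c e] sA]|no].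
  rewrite e sub1set in sA; rewrite (bigD1 c) //= inE e eqxx big1 // => d /andP[_ dc].
  by rewrite inE e; case: eqP => // /set1_inj cd; rewrite cd eqxx in dc.
rewrite big1 // => c cA; rewrite inE; case: (rs r =P [set c]) => // e.
by rewrite e cards1 sub1set cA in no.
Qed.

Variable (col : 'I_3 -> 'I_k -> 'I_n).
Hypothesis col_inj : forall p i p' i', col p i = col p' i' -> p = p' /\ i = i'.

Definition part p : {set 'I_n} := [set col p i | i in 'I_k].

Lemma card_part p : #|part p| = k.
Proof. by rewrite card_imset ?card_ord // => i j /col_inj[]. Qed.

Lemma part_eq p p' c : c \in part p -> c \in part p' -> p = p'.
Proof. by case/imsetP => i _ ->; case/imsetP => i' _ /col_inj[]. Qed.

Lemma disjoint_part p p' : p != p' -> [disjoint part p & part p'].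
Proof.
move=> pp'; rewrite -setI_eq0; apply/eqP/setP => c; rewrite !inE; apply/negP => /andP[h h'].
by rewrite (part_eq h h') eqxx in pp'.
Qed.

Definition part_singles p := [set r in single_rows | rs r \subset part p].

Lemma card_part_singles p :
  #|part_singles p| = \sum_i #|[set r | rs r == [set col p i]]|.
Proof.
by rewrite -sum_single_rows big_imset //= => i j _ _ /col_inj[].
Qed.

(** Column pairs assigned to type u: those between the two other parts, and those
    inside the first of these parts.  Every column pair inside the union of the
    parts is thus assigned exactly once, and evenly. *)
Definition edges (u : 'I_3) : {set {set 'I_n}} :=
  [set Q : {set 'I_n} | (Q \subset part (ordS u) :|: part (ordS (ordS u))) && (#|Q| == 2)]
  :\: [set Q : {set 'I_n} | (Q \subset part (ordS (ordS u))) && (#|Q| == 2)].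

Lemma card_edges u : #|edges u| = 'C(2 * k, 2) - 'C(k, 2).
Proof.
have ne : ordS u != ordS (ordS u) by rewrite eq_sym ordS_neq.
rewrite cardsD (setIidPr _); last first.
  apply/subsetP => Q; rewrite !inE => /andP[h ->]; rewrite andbT.
  by rewrite (subset_trans h) ?subsetUr.
rewrite !cards_draws cardsU disjoint_setI0 ?disjoint_part // cards0 subn0 !card_part.
by rewrite mul2n addnn.
Qed.

Lemma edges_next u Q : Q \in edges u -> Q \notin edges (ordS u).
Proof.
rewrite !inE => /andP[no /andP[h Q2]]; rewrite Q2 !andbT in no *.
apply/negP => /andP[_ h']; case/negP: no; apply/subsetP => c cQ.
move: (subsetP h c cQ) (subsetP h' c cQ); rewrite !inE.
case/orP => // c1 /orP[//|c3]; have := part_eq c1 c3.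
by case: u {h h' c1 c3} => [[|[|[|]]]].
Qed.

Lemma edges_disjoint u v Q : Q \in edges u -> Q \in edges v -> u = v.
Proof.
move=> hu hv; have := edges_next hu; have := edges_next hv.
have [//|uv] := eqVneq u v.
have [e|e] : v = ordS u \/ u = ordS v.
  by move: uv; case: u {hu} => [[|[|[|]]] // ?]; case: v {hv} => [[|[|[|]]] // ?] ?;
     by [left; apply: val_inj|right; apply: val_inj].
- by move=> _; rewrite -e hv.
- by rewrite -e hu.
Qed.

Definition edge_rows u := [set r | rs r \in edges u].

Lemma card_edge_rows u : #|edge_rows u| = 'C(2 * k, 2) - 'C(k, 2).
Proof.
rewrite -(card_edges u) -!sum1_card (partition_big rs (mem (edges u))) /=; last first.
  by move=> r; rewrite inE.
apply: eq_bigr => Q QE; rewrite sum1dep_card -[RHS](@card_rows_eq Q); last first.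
  by move: QE; rewrite !inE => /andP[_ /andP[_ /eqP]].
apply: eq_card => r; rewrite !inE; case: (rs r =P Q) => [->|]; last by rewrite andbF.
by move: QE; rewrite !inE => ->.
Qed.

Definition num_edges := 'C(2 * k, 2) - 'C(k, 2).
Hypothesis q_le : q <= num_edges.
Variable S : 'I_3 -> {set 'I_m}.
Hypothesis hS : forall u, [/\ #|S u| = q, S u \subset single_rows,
  [disjoint S u & part_singles u] & forall v, u != v -> [disjoint S u & S v]].
Variable r0 : 'I_m.

(** The single rows come first.  As q <= num_edges, the second half of the list
    consists of edge rows, so of the rows with indices j and rev_ord j at least
    one is an edge row, whose base cells lie in the parts. *)
Definition row_list u := enum (S u) ++ enum (edge_rows u).
Definition typed_row u (j : 'I_(q + num_edges)) := nth r0 (row_list u) j.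

Lemma size_row_list u : size (row_list u) = q + num_edges.
Proof. by case: (hS u) => e _ _ _; rewrite size_cat -!cardE e card_edge_rows. Qed.

Lemma edge_rows2 u r : r \in edge_rows u -> #|rs r| = 2.
Proof. by rewrite !inE => /andP[_ /andP[_ /eqP]]. Qed.

Lemma row_list_uniq u : uniq (row_list u).
Proof.
rewrite cat_uniq !enum_uniq andbT /=; apply/hasPn => r; rewrite !mem_enum => /edge_rows2 r2.
case: (hS u) => _ /subsetP sY _ _; apply/negP => /sY; by rewrite inE r2.
Qed.

Lemma row_list_disjoint u v r : r \in row_list u -> r \in row_list v -> u = v.
Proof.
rewrite !mem_cat !mem_enum.
case: (hS u) => _ /subsetP sYu _ dS; case: (hS v) => _ /subsetP sYv _ _.
case/orP => ru; case/orP => rv.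
- have [//|uv] := eqVneq u v; have := dS _ uv; rewrite -setI_eq0 => /eqP/setP/(_ r).
  by rewrite !inE ru rv.
- by have := sYu _ ru; rewrite inE (edge_rows2 rv).
- by have := sYv _ rv; rewrite inE (edge_rows2 ru).
- by move: ru rv; rewrite inE => ru; rewrite inE; exact: edges_disjoint.
Qed.

Lemma typed_row_mem u j : typed_row u j \in row_list u.
Proof. by rewrite mem_nth // size_row_list ltn_ord. Qed.

Lemma typed_row_edge u (j : 'I_(q + num_edges)) : q <= j -> typed_row u j \in edge_rows u.
Proof.
move=> qj; rewrite -mem_enum /typed_row /row_list nth_cat -cardE.
case: (hS u) => -> _ _ _; rewrite ltnNge qj /= mem_nth // -cardE card_edge_rows.
by have := ltn_ord j; rewrite /num_edges in j qj *; lia.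
Qed.

Lemma typed_layout : layout B col typed_row.
Proof.
split.
- exact: col_inj.
- move=> u j u' j' e; have eu : u = u'.
    by apply: (@row_list_disjoint _ _ (typed_row u j)); [|rewrite e]; exact: typed_row_mem.
  split=> //; apply: val_inj => /=; move: e; rewrite /typed_row -eu => /eqP.
  by rewrite nth_uniq ?size_row_list ?ltn_ord ?row_list_uniq // => /eqP.
- by move=> r; case: (rows12 r) => ->.
- move=> u j i; apply/negP => inB.
  have cr : col u i \in rs (typed_row u j) by rewrite inE.
  have cA : col u i \in part u by rewrite imset_f.
  have := typed_row_mem u j; rewrite mem_cat !mem_enum => /orP[rS|].
    case: (hS u) => _ /subsetP sY dP _; have := sY _ rS; rewrite inE => /cards1P[c e].
    move: dP; rewrite -setI_eq0 => /eqP/setP/(_ (typed_row u j)); rewrite !inE rS e cards1 eqxx /=.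
    by rewrite e inE in cr; rewrite sub1set -(eqP cr) cA.
  rewrite !inE => /andP[_ /andP[/subsetP/(_ _ cr)]]; rewrite inE => /orP[] c2 _.
    by have := part_eq cA c2 => e; have := ordS_neq u; rewrite -e eqxx.
  by have := part_eq cA c2 => e; have := ordSS_neq u; rewrite -e eqxx.
have aux u (j : 'I_(q + num_edges)) y : q <= j -> (typed_row u j, y) \in B ->
    exists p i, y = col p i.
  move=> qj yB; have := typed_row_edge u qj; rewrite !inE => /andP[_ /andP[/subsetP/(_ y)]].
  rewrite !inE => /(_ yB) /orP[] /imsetP[i _ ->] _; by eexists; eexists.
move=> u v j y h1 h2; have [qj|jq] := leqP q j; first exact: aux qj h1.
apply: aux h2; rewrite /=; have := q_le; have := ltn_ord j.
lia.
Qed.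

End Build.

Lemma layout_bound m n k q (B : {set cell m n}) :
  (forall r, #|row_support B r| = 1 \/ #|row_support B r| = 2) ->
  (forall Q : {set 'I_n}, #|Q| = 2 -> #|rows_over B Q| = 1) ->
  0 < m -> 3 * k + 1 <= n -> 3 * q <= m - 'C(n, 2) -> q <= num_edges k ->
  3 * (q + num_edges k) * k <= Tstar B + #|B|.
Proof.
move=> rows12 over1 m0 kn qs qe.
have [col [col_inj [W10 W21 W0]]] :=
  deal_columns (fun c => #|[set r | row_support B r == [set c]]|) kn.
have hP p := card_part_singles B col_inj p.
rewrite -!hP in W10 W21 W0.
have dP p p' : p != p' -> [disjoint part_singles B col p & part_singles B col p'].
  move=> pp'; rewrite -setI_eq0; apply/eqP/setP => r; rewrite !inE; apply/negP.
  move=> /andP[/andP[/cards1P[c ->]]]; rewrite !sub1set => h /andP[_ h'].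
  by rewrite (part_eq col_inj h h') eqxx in pp'.
have sub p : part_singles B col p \subset single_rows B.
  by apply/subsetP => r; rewrite inE => /andP[].
have sT : \sum_c #|[set r | row_support B r == [set c]]| <= #|single_rows B|.
  rewrite (eq_bigl (fun c => c \in setT)) => [|c]; last by rewrite in_setT.
  rewrite sum_single_rows.
  by apply: subset_leq_card; apply/subsetP => r; rewrite inE => /andP[].
have [|||||||S hS] :=
  @three_way_split _ (single_rows B) _ _ _ q (sub (inord 0)) (sub (inord 1)) (sub (inord 2)).
- by apply: dP; rewrite -val_eqE /= !inordK.
- by apply: dP; rewrite -val_eqE /= !inordK.
- by apply: dP; rewrite -val_eqE /= !inordK.
- exact: W10.
- exact: W21.
- exact: leq_trans W0 sT.
- by rewrite (card_single_rows rows12 over1).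
have hS' u : [/\ #|S u| = q, S u \subset single_rows B,
  [disjoint S u & part_singles B col u] & forall v, u != v -> [disjoint S u & S v]].
  have [h1 h2 h3 h4] := hS u; split=> //.
  suff e : nth set0 [:: part_singles B col (inord 0); part_singles B col (inord 1);
            part_singles B col (inord 2)] u = part_singles B col u by rewrite -e.
  by case: u {h1 h2 h3 h4} => [[|[|[|]]] // h] /=; congr (part_singles B col _);
     apply: val_inj; rewrite /= inordK.
have L := typed_layout rows12 over1 col_inj qe hS' (Ordinal m0).
apply: leq_trans (layout_family_card L) _; rewrite leq_add2r.
exact: (leq_bigmax_cond (F := fun E : {set {set cell m n}} => #|E|) _ (layout_family_admissible L)).
Qed.

Lemma double_num_edges k : 2 * num_edges k + k = 3 * (k * k).
Proof.
rewrite /num_edges mulnBr !double_bin2; case: k => // k.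
have -> : (2 * k.+1).-1 = (2 * k).+1 by lia.
have -> : k.+1.-1 = k by [].
nia.
Qed.

(** * The two bounds *)

(** Here nk stands for num_edges k, about n ^ 2 / 6, and q is the number of single
    rows given to each type.  Then 3 (q + nk) is at least mu - 7n, and 3k is at
    least n - 3. *)
Lemma layout_arith m n mu k nk q : 54 <= n -> n <= m -> n * n.-1 <= 2 * m ->
  mu <= m -> mu <= n * n -> n <= 3 * k + 3 -> 2 * nk + k = 3 * (k * k) ->
  q = minn ((m - (n * n.-1) %/ 2) %/ 3) nk ->
  n * mu <= 9 * (q + nk) * k + 24 * m.
Proof.
move=> n54 nm tri mum mun nk3 nkE qE.
have nn3 : n * n <= 3 * m.
  by case: n n54 nm tri {mun nk3 qE} => // n _ /= nm tri; nia.
have a1 : (n - 3) * (n - 4) <= 6 * nk.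
  have -> : 6 * nk = (3 * k) * (3 * k - 1) by rewrite mulnBr muln1; nia.
  by apply: leq_mul; lia.
have a1' : n * n + 12 <= 6 * nk + 7 * n.
  by move: a1; rewrite mulnBr !mulnBl; clear - n54; nia.
set h := (n * n.-1) %/ 2 in qE.
have h2 : 2 * h <= n * n.-1 by rewrite mulnC leq_trunc_div.
set s := (m - h) %/ 3 in qE.
have s3 : m <= 3 * s + 2 + h by rewrite /s; lia.
have nn1 : n * n.-1 + n = n * n.
  by case: n n54 {nm tri mun nk3 qE nn3 a1 a1' h h2 s s3} => // n _ /=; nia.
have key : mu <= 3 * (q + nk) + 7 * n.
  rewrite qE /minn; case: ifP => _; last by move: a1' mun; clear; lia.
  by move: a1' s3 h2 nn1 mum n54; clear; lia.
have [small|big] := leqP mu (7 * n).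
  apply: leq_trans (_ : 24 * m <= _); last exact: leq_addl.
  apply: leq_trans (_ : n * (7 * n) <= _); first by rewrite leq_mul2l small orbT.
  by move: nn3; clear; nia.
have X0 : (mu - 7 * n) * (n - 3) <= 3 * (q + nk) * (3 * k) by apply: leq_mul; lia.
have -> : 9 * (q + nk) * k = 3 * (q + nk) * (3 * k) by ring.
apply: leq_trans (leq_add X0 (leqnn _)).
rewrite mulnBr !mulnBl.
move: nn3 mum n54 big; clear; nia.
Qed.

(** For n < 54 the left-hand side is at most 60 m. *)
Lemma Tstar_lower_bound m n (B : {set cell m n}) :
  2 <= n -> n <= m -> 'C(n, 2) <= m -> maximum_base B ->
  n * minn m (n ^ 2) <= 3 * Tstar B + 60 * m.
Proof.
move=> n2 nm Cm /andP[c4 /eqP cB].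
have n0 : 0 < n by exact: ltnW.
rewrite (zarankiewicz_eq n0 Cm) in cB.
have [rows12 over1] := extremal_base c4 cB.
have [n54|n54] := ltnP n 54.
  apply: leq_trans (_ : 60 * m <= _); last exact: leq_addl.
  apply: leq_mul; [exact: leq_trans (ltnW n54) _ | exact: geq_minl].
pose k := (n - 1) %/ 3.
pose q := minn ((m - 'C(n, 2)) %/ 3) (num_edges k).
have kn : 3 * k + 1 <= n by rewrite /k; lia.
have qs : 3 * q <= m - 'C(n, 2).
  apply: leq_trans (_ : 3 * ((m - 'C(n, 2)) %/ 3) <= _); first by rewrite leq_mul2l geq_minl.
  by rewrite mulnC leq_trunc_div.
have h := layout_bound rows12 over1 (leq_trans n0 nm) kn qs (geq_minr _ _).
have e2 := double_bin2 n.
have := @layout_arith m n (minn m (n ^ 2)) k (num_edges k) q n54 nm.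
have e3 : (n * n.-1) %/ 2 = 'C(n, 2) by rewrite -e2 mulKn.
rewrite e3 => /(_ _ (geq_minl _ _) _ _ (double_num_edges k) erefl) H0.
have {H0} : n * minn m (n ^ 2) <= 9 * (q + num_edges k) * k + 24 * m.
  apply: H0; first by rewrite -e2 leq_mul2l.
    by rewrite mulnn geq_minr.
  by rewrite /k; lia.
move: h; rewrite cB; set X := q + _; set Y := Tstar B; set Z := minn _ _.
move: Cm; set C := 'C(n, 2); clear -n0 => Cm h; nia.
Qed.

Local Open Scope ring_scope.

Theorem theorem13 (R : realType) :
  (forall m n : nat, (2 <= n)%N -> (n <= m)%N -> ('C(n, 2) <= m)%N ->
     forall B : {set cell m n}, maximum_base B ->
       n%:R / 3 * (minn m (n ^ 2))%:R - 20 * m%:R <= (Tstar B)%:R :> R)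
  /\
  (exists kappa : R, 0 < kappa /\
     forall m n : nat, (2 <= n)%N -> (n <= m)%N -> (n ^ 2 <= m)%N ->
       forall B : {set cell m n}, canonical_base B ->
         maximum_base B /\
         (Tstar B)%:R <= m%:R * n%:R / 3
                         - kappa * n%:R * (m%:R - n%:R ^+ 2)
                         + 4 * m%:R :> R).
Proof.
split=> [m n n2 nm Cm B mB|].
  have := Tstar_lower_bound n2 nm Cm mB; rewrite -(ler_nat R) natrD !natrM.
  set a := n%:R; set b := (minn _ _)%:R; lra.
exists (5000 * 1000)^-1; split=> [|m n n2 nm nnm B cB]; first by rewrite invr_gt0 mulr_gt0.
have Cm : ('C(n, 2) <= m)%N by have := double_bin2_le n; lia.
split; first exact: canonical_maximum (ltnW n2) Cm cB.
have := canonical_upper_bound R n2 nnm cB.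
have m0 : 0 <= m%:R :> R by [].
set T := (Tstar B)%:R; set x := n%:R * _ => h.
have : x / (5000 * 1000) <= m%:R * n%:R / 3 + 3 * m%:R - T.
  by rewrite ler_pdivrMr ?mulr_gt0 // mulrC.
rewrite (_ : _^-1 * _ * _ = x / (5000 * 1000)); last by rewrite /x -mulrA mulrC.
move: m0; set y := x / _; set z := m%:R * n%:R / 3; set M := m%:R.
lra.
Qed.
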